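(* Let $\ell\geq5$ be an integer and let $G$ be a graph with girth $2\ell+1$ and no odd hole of length at least $2\ell+3$. If $G$ is $4$-vertex-critical, then $G$ does not contain a balanced $K_4$-subdivision of type $(1,2)$.
   Context: Graphs are finite and simple; for a path $F$, $|F|$ denotes its number of edges. A hole is an induced cycle of length at least four; odd/even according to its length. A graph $G$ is $4$-vertex-critical if its chromatic number is $4$ and $G-v$ has chromatic number at most $3$ for every vertex $v$. For a graph $H$ isomorphic to a subdivision of $K_4$, an arris is a path of $H$ whose ends are degree-3 vertices and which contains exactly two degree-3 vertices of $H$; the face cycles are the four cycles each formed by three arrises joining three of the four degree-3 vertices. $G$ contains a balanced $K_4$-subdivision of type $(1,2)$ if $G$ has an induced subgraph $H$ isomorphic to a subdivision of $K_4$ whose degree-3 vertices and arrises can be labelled $u_1,u_2,u_3,u_4$ and $P_1$ ($u_1u_2$), $P_2$ ($u_3u_4$), $Q_1$ ($u_2u_3$), $Q_2$ ($u_1u_4$), $L_1$ ($u_1u_3$), $L_2$ ($u_2u_4$) (where the parenthesis gives the ends) such that $P_1\cup Q_1\cup L_1$ and $P_1\cup Q_2\cup L_2$ are odd holes of $G$, $P_2\cup Q_1\cup L_2$ and $P_2\cup Q_2\cup L_1$ are even holes of $G$, $|Q_1|=1$ and $|L_2|>1$. *)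

(* Defs.v *)
From mathcomp Require Import all_boot.

Set Implicit Arguments.
Unset Strict Implicit.
Unset Printing Implicit Defensive.

Record sgraph := SGraph {
  vertex :> finType;
  adj : rel vertex;
  adj_sym : symmetric adj;
  adj_irrefl : irreflexive adj }.

Section Basics.
Variable G : sgraph.

Definition degree (x : G) : nat := #|[set y | adj x y]|.

Definition colorable (k : nat) : bool :=
  [exists f : {ffun G -> 'I_k},
    [forall x, forall y, adj x y ==> (f x != f y)]].

Lemma colorable_ex : exists k, colorable k.
Proof.
exists #|G|; apply/existsP; exists [ffun x => enum_rank x].
apply/forallP=> x; apply/forallP=> y; apply/implyP=> exy; rewrite !ffunE.
apply/negP=> /eqP/enum_rank_inj xy.
by rewrite xy adj_irrefl in exy.
Qed.

Definition chromatic_number : nat := ex_minn colorable_ex.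

(* A cycle is the list of its vertices in cyclic order, the last one being
   adjacent to the first; its length is its [size]. *)
Definition is_cycle (c : seq G) : bool :=
  [&& 3 <= size c, uniq c & cycle (@adj G) c].

Definition has_girth (g : nat) : Prop :=
  (exists2 c, is_cycle c & size c = g) /\
  (forall c, is_cycle c -> g <= size c).

Definition is_hole (c : seq G) : Prop :=
  [/\ is_cycle c, 4 <= size c &
      {in c &, forall x y, adj x y -> y = next c x \/ x = next c y}].

Definition odd_hole (c : seq G) : Prop := is_hole c /\ odd (size c).
Definition even_hole (c : seq G) : Prop := is_hole c /\ ~~ odd (size c).

(* A path is the list of all its vertices, both ends included. *)
Definition is_path (u v : G) (p : seq G) : Prop :=
  exists q, [/\ p = u :: q, path (@adj G) u q, uniq p & last u q = v].

Definition plength (p : seq G) : nat := (size p).-1.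

Definition on_path_edge (p : seq G) (x y : G) : bool :=
  infix [:: x; y] p || infix [:: y; x] p.

(* The list of vertices of the closed walk p, q, r, where p goes from a to b,
   q from b to c, and r from c back to a. *)
Definition close3 (p q r : seq G) : seq G := behead p ++ behead q ++ behead r.

End Basics.

Section Induced.
Variables (G : sgraph) (S : {set G}).

Definition induced_adj : rel {x : G | x \in S} :=
  [rel x y | adj (val x) (val y)].

Lemma induced_sym : symmetric induced_adj.
Proof. by move=> x y; apply: adj_sym. Qed.

Lemma induced_irrefl : irreflexive induced_adj.
Proof. by move=> x; apply: adj_irrefl. Qed.

Definition induced : sgraph := SGraph induced_sym induced_irrefl.

Definition to_ambient (p : seq induced) : seq G :=
  [seq val x | x : {x : G | x \in S} <- p].

End Induced.

Definition vertex_critical4 (G : sgraph) : Prop :=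
  chromatic_number G = 4 /\
  forall v : G, chromatic_number (induced [set~ v]) <= 3.

Section Complete.
Variable n : nat.

Definition complete_adj : rel 'I_n := [rel i j | i != j].

Lemma complete_sym : symmetric complete_adj.
Proof. by move=> i j; rewrite /complete_adj /= eq_sym. Qed.

Lemma complete_irrefl : irreflexive complete_adj.
Proof. by move=> i; rewrite /complete_adj /= eqxx. Qed.

Definition complete : sgraph := SGraph complete_sym complete_irrefl.

End Complete.

(* H is (up to isomorphism) obtained from F by replacing its edges xy by
   internally disjoint paths [p x y] joining the images [b x] and [b y] of
   their ends. *)
Definition is_subdivision (F H : sgraph) : Prop :=
  exists (b : F -> H) (p : F -> F -> seq H),
    [/\ injective b,
        forall x y, adj x y -> is_path (b x) (b y) (p x y)
                               /\ p y x = rev (p x y),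
        forall x y z, adj x y -> b z \in p x y -> z = x \/ z = y,
        forall x y x' y', adj x y -> adj x' y' -> [set x; y] != [set x'; y'] ->
          forall h, h \in p x y -> h \in p x' y' -> exists z, h = b z &
        (forall h : H, (exists z, h = b z)
                       \/ (exists x y, adj x y /\ h \in p x y)) /\
        (forall h k : H, adj h k ->
           exists x y, adj x y /\ on_path_edge (p x y) h k)].

Definition is_arris (H : sgraph) (u v : H) (p : seq H) : Prop :=
  [/\ is_path u v p, degree u = 3, degree v = 3 &
      #|[set x in p | degree x == 3]| = 2].

Definition contains_balanced_K4_subdivision_12 (G : sgraph) : Prop :=
  exists S : {set G},
  let H := induced S in
  is_subdivision (complete 4) H /\
  exists (u1 u2 u3 u4 : H) (P1 P2 Q1 Q2 L1 L2 : seq H),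
    [/\ uniq [:: u1; u2; u3; u4] /\
        [set x : H | degree x == 3] = [set u1; u2; u3; u4],
        [/\ is_arris u1 u2 P1, is_arris u3 u4 P2, is_arris u2 u3 Q1,
            is_arris u1 u4 Q2 & is_arris u1 u3 L1 /\ is_arris u2 u4 L2],
        odd_hole (to_ambient (close3 P1 Q1 (rev L1))) /\
        odd_hole (to_ambient (close3 P1 L2 (rev Q2))),
        even_hole (to_ambient (close3 Q1 P2 (rev L2))) /\
        even_hole (to_ambient (close3 L1 P2 (rev Q2))) &
        plength Q1 = 1 /\ 1 < plength L2].

(* Main.v *)
(* Write a, b, p for the numbers of edges of P1, Q2, P2. Parity forces P1 Q1 P2 Q2 to be an
   odd hole, so a + b + p = 2l, |L1| = 2l - a, |L2| = p + 1 and p >= l. Let z be the middle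
   vertex of P2, with neighbours z3 and z4 on P2 towards u3 and u4.

   A 4-vertex-critical graph of this kind has no star cutset: give the centre x the same
   colour in 3-colourings of both sides; the vertices of the other two colours contain an
   odd hole, but a (2l+1)-cycle meets the neighbourhood of x at most once.

   Let F be the component, in the graph without the subdivision H, N(z3) and N(z4), of a third
   neighbour of z. A shortest path through F from z to another vertex of H closes up with the
   induced paths of H to holes, whose lengths and parities are contradictory; so F attaches to
   H only at z. If F had outer neighbours both in N(z3) and in N(z4), then a path through F
   from z4 to z3 would replace z both in the odd hole P1 Q1 P2 Q2 and in the even hole P2 Q1
   L2, one of the results being an odd hole that is too long. Hence F is cut off by a subset
   of N[z3] or of N[z4], a star cutset. *)
Require Import Defs.
From mathcomp Require Import all_boot perm zify.

Set Implicit Arguments.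
Unset Strict Implicit.
Unset Printing Implicit Defensive.

(** * Colourings *)

Definition proper_on (G : sgraph) k (A : {pred G}) (f : G -> 'I_k) : Prop :=
  {in A &, forall x y, adj x y -> f x != f y}.

Lemma chromatic_number_leP (G : sgraph) k :
  reflect (exists f : G -> 'I_k, proper_on predT f) (chromatic_number G <= k).
Proof.
rewrite /chromatic_number; case: ex_minnP => m col_m min_m.
apply: (iffP idP) => [le_mk|[g gP]].
  have /existsP[f fP] := col_m.
  exists (widen_ord le_mk \o f) => x y _ _ xy.
  have := implyP (forallP (forallP fP x) y) xy.
  by apply: contra => /eqP/(congr1 val)/= fxy; apply/eqP/val_inj.
apply: min_m; apply/existsP; exists (finfun g).
by apply/forallP=> x; apply/forallP=> y; apply/implyP=> xy; rewrite !ffunE gP.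
Qed.

Lemma critical4_not_3colorable (G : sgraph) (f : G -> 'I_3) :
  vertex_critical4 G -> ~ proper_on predT f.
Proof.
by case=> chi4 _ fP; have /chromatic_number_leP := ex_intro _ f fP; rewrite chi4.
Qed.

Lemma critical4_3coloring_off (G : sgraph) (v : G) :
  vertex_critical4 G -> exists f : G -> 'I_3, proper_on (predC1 v) f.
Proof.
case=> _ /(_ v)/chromatic_number_leP[f fP].
exists (fun x => oapp f ord0 (insub x)) => x y xv yv xy.
have [xS yS] : x \in [set~ v] /\ y \in [set~ v] by rewrite !inE.
by rewrite (insubT (mem [set~ v]) xS) (insubT (mem [set~ v]) yS) fP.
Qed.

Lemma degree_ge_uncolorable (G : sgraph) k (v : G) (f : G -> 'I_k) :
    proper_on (predC1 v) f -> (forall g : G -> 'I_k, ~ proper_on predT g) ->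
  k <= degree v.
Proof.
move=> fP uncol; rewrite leqNgt; apply/negP => deg_lt.
have [c cP] : exists c, c \notin [set f x | x in [set y | adj v y]].
  apply/existsP; apply: contraLR deg_lt; rewrite negb_exists -leqNgt => /forallP all_used.
  rewrite -[k]card_ord; apply: leq_trans (leq_imset_card f _).
  by apply/subset_leq_card/subsetP => c _; have := all_used c; rewrite negbK.
have c_nbr x : adj v x -> c != f x.
  by move=> vx; apply: contraNneq cP => ->; apply/imset_f; rewrite inE.
apply: (uncol (fun x => if x == v then c else f x)) => x y _ _ xy.
have [xv|xv] := eqVneq x v; have [yv|yv] := eqVneq y v.
- by rewrite xv yv adj_irrefl in xy.
- by rewrite c_nbr -?xv.
- by rewrite eq_sym c_nbr // -yv adj_sym.
- exact: fP.
Qed.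

Lemma critical4_degree_ge3 (G : sgraph) (v : G) : vertex_critical4 G -> 3 <= degree v.
Proof.
move=> crit; have [f fP] := critical4_3coloring_off v crit.
by apply: degree_ge_uncolorable fP _ => g; apply: critical4_not_3colorable crit.
Qed.

(** * Closed walks *)

Lemma infix_mem2 (T : eqType) (s : seq T) x y :
  infix [:: x; y] s -> (x \in s) && (y \in s).
Proof. by case/infixP=> s1 [s2 ->]; rewrite !mem_cat !inE !eqxx !orbT. Qed.

Lemma infix2_next (T : eqType) (s c : seq T) x y z :
  uniq (s ++ x :: c) -> infix [:: x; y] (s ++ x :: c) -> y = head z c.
Proof.
move=> us /infixP[t1 [t2 sE]].
have index_s : index x (s ++ x :: c) = size s.
  rewrite index_cat /= eqxx addn0.
  by move: us; rewrite cat_uniq /= negb_or => /and3P[_ /andP[/negbTE->]].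
have index_t1 : index x (s ++ x :: c) = size t1.
  move: us; rewrite sE index_cat /= eqxx addn0 cat_uniq /= negb_or.
  by case/and3P=> _ /andP[/negbTE->].
have := congr1 (drop (size s).+1) sE; rewrite -add1n -!drop_drop.
by rewrite drop_size_cat // -index_s index_t1 drop_size_cat //= !drop0 => ->.
Qed.

Section ClosedWalks.
Variable G : sgraph.
Implicit Types (c d : seq G) (x y : G) (T : pred G).

Lemma mem_split x (s : seq G) :
  x \in s -> exists s1 s2 : seq G, s = s1 ++ x :: s2.
Proof. by case/splitPr=> s1 s2; exists s1, s2. Qed.

Lemma not_uniq_split (s : seq G) :
  ~~ uniq s -> exists x (s1 s2 s3 : seq G), s = s1 ++ x :: s2 ++ x :: s3.
Proof.
elim: s => //= y s IHs; rewrite negb_and negbK => /orP[/mem_split[s2 [s3 ->]]|/IHs].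
  by exists y, [::], s2, s3.
by case=> x [s1 [s2 [s3 ->]]]; exists x, (y :: s1), s2, s3.
Qed.

Definition chordless c : Prop :=
  {in c &, forall x y, adj x y -> y = next c x \/ x = next c y}.

Definition shorter_odd_walk c : Prop :=
  exists d, [/\ cycle (@adj G) d, odd (size d), size d < size c & {subset d <= c}].

Lemma odd_walk_repeat c :
  cycle (@adj G) c -> odd (size c) -> ~~ uniq c -> shorter_odd_walk c.
Proof.
move=> cyc oddc /not_uniq_split[x [s1 [s2 [s3 cE]]]].
have size_c : size c = size (x :: s2) + size (x :: s3 ++ s1).
  by rewrite cE /= !size_cat /= !size_cat /=; lia.
have sub2 : {subset x :: s2 <= c}.
  by move=> v; rewrite cE !(mem_cat, inE) => /orP[]->; rewrite ?orbT.
have sub31 : {subset x :: s3 ++ s1 <= c}.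
  by move=> v; rewrite cE !(mem_cat, inE) => /or3P[]->; rewrite ?orbT.
have [cyc2 cyc31] : cycle (@adj G) (x :: s2) /\ cycle (@adj G) (x :: s3 ++ s1).
  move: cyc; rewrite -(rot_cycle (size s1)) cE rot_size_cat /= -catA rcons_cat.
  by rewrite cat_path /= => /and3P[path2 e2 ->]; rewrite rcons_path path2.
case: (boolP (odd (size (x :: s2)))) => [odd2|even2].
  by exists (x :: s2); split=> //; rewrite size_c /=; lia.
exists (x :: s3 ++ s1); split=> //; last by rewrite size_c /=; lia.
by move: oddc; rewrite size_c oddD (negbTE even2).
Qed.

Lemma odd_walk_chord c x y :
    cycle (@adj G) c -> odd (size c) -> uniq c -> x \in c -> y \in c ->
    adj x y -> y != next c x -> x != next c y ->
  shorter_odd_walk c.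
Proof.
move=> cyc oddc uc xc yc xy y_next x_next.
have [i s rotE] := rot_to xc.
have nextE : next c =1 next (x :: s) by move=> v; rewrite -rotE next_rot.
have memE : c =i x :: s by move=> v; rewrite -rotE mem_rot.
have us : uniq (x :: s) by rewrite -rotE rot_uniq.
move: cyc oddc; rewrite -(rot_cycle i) -(size_rot i) rotE => cyc oddc.
have /mem_split[s1 [s2 sE]] : y \in s.
  by move: yc; rewrite memE inE => /orP[/eqP yx|//]; rewrite yx adj_irrefl in xy.
subst s; rewrite /shorter_odd_walk -(size_rot i) rotE.
have [cyc1 cyc2] : cycle (@adj G) (x :: rcons s1 y) /\ cycle (@adj G) (y :: rcons s2 x).
  move: cyc; rewrite /= rcons_cat cat_path /= => /and3P[path1 e1 path2].
  by rewrite !rcons_path !last_rcons path1 e1 xy adj_sym xy -rcons_path path2.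
have sub1 : {subset x :: rcons s1 y <= c}.
  move=> v; rewrite memE !inE mem_rcons mem_cat !inE.
  by case/or3P=> ->; rewrite ?orbT.
have sub2 : {subset y :: rcons s2 x <= c}.
  move=> v; rewrite memE !inE mem_rcons mem_cat !inE.
  by case/or3P=> ->; rewrite ?orbT.
have s1_gt0 : 0 < size s1.
  by case: (s1) nextE => // nextE; rewrite nextE /= !eqxx in y_next.
have s2_gt0 : 0 < size s2.
  case: (s2) nextE us => // nextE us; move: x_next; rewrite nextE.
  by rewrite -(next_rot (size (x :: s1)) us) -cat_cons rot_size_cat /= !eqxx.
case: (boolP (odd (size (x :: rcons s1 y)))) => odd1.
  by exists (x :: rcons s1 y); split=> //; rewrite /= size_rcons size_cat /=; clear -s2_gt0; lia.
exists (y :: rcons s2 x); split=> //; last first.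
  by rewrite /= size_rcons size_cat /=; clear -s1_gt0; lia.
by move: odd1 oddc; rewrite /= !size_rcons size_cat /=; clear; lia.
Qed.

(* Repeated vertices and chords split an odd closed walk into two closed walks, one of
   which is odd. *)
Lemma odd_closed_walk_chordless_cycle c :
    cycle (@adj G) c -> odd (size c) ->
  exists d, [/\ is_cycle d, odd (size d), chordless d & {subset d <= c}].
Proof.
have [n] := ubnP (size c); elim: n c => // n IHn c le_cn cyc oddc.
have shorten : shorter_odd_walk c ->
    exists d, [/\ is_cycle d, odd (size d), chordless d & {subset d <= c}].
  case=> d [cycd oddd lt_dc sub_dc].
  have [d' [? ? ? sub_d'd]] := IHn d (leq_trans lt_dc le_cn) cycd oddd.
  by exists d'; split=> // v /sub_d'd/sub_dc.
have [uc|] := boolP (uniq c); last by move/(odd_walk_repeat cyc oddc)/shorten.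
have [/forall_inP chord|] := boolP [forall x in c, [forall y in c,
    adj x y ==> ((y == next c x) || (x == next c y))]]; last first.
  case/forall_inPn=> x xc /forall_inPn[y yc]; rewrite negb_imply negb_or.
  by case/and3P=> xy ny nx; apply/shorten/(odd_walk_chord cyc oddc uc xc yc).
exists c; split=> // [|x y xc yc xy].
  rewrite /is_cycle uc cyc !andbT.
  by case: (c) oddc cyc => [|x [|y []]] //=; rewrite adj_irrefl.
have /forall_inP/(_ y yc)/implyP/(_ xy) := chord x xc.
by case/orP=> /eqP; [left|right].
Qed.

Definition adj_in T x y : bool := [&& adj x y, T x & T y].
Arguments adj_in T x y /.

Lemma connect_adj_in_sym T : connect_sym (adj_in T).
Proof. by apply: sym_connect_sym => x y /=; rewrite adj_sym (andbC (T x)). Qed.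

Lemma path_adj_in T x p : path (adj_in T) x p -> path (@adj G) x p && all T p.
Proof. by elim: p x => //= y p IHp x /andP[/and3P[-> _ ->] /IHp]. Qed.

Lemma connect_adj_in T x y : T x -> connect (adj_in T) x y -> T y.
Proof.
move=> Tx /connectP[p /path_adj_in/andP[_ Tp] ->].
by have := mem_last x p; rewrite inE => /orP[/eqP->|/(allP Tp)].
Qed.

Definition double_cover T (u v : G * bool) : bool :=
  adj_in T u.1 v.1 && (u.2 != v.2).
Arguments double_cover T u v /.

Lemma double_cover_odd_closed_walk T x :
    connect (double_cover T) (x, false) (x, true) ->
  exists c, [/\ cycle (@adj G) c, odd (size c) & all T c].
Proof.
case/connectP=> p pP lp; exists (unzip1 p).
have coverP u q : path (double_cover T) u q ->
    path (adj_in T) u.1 (unzip1 q) && ((last u q).2 == u.2 (+) odd (size q)).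
  elim: q u => [|v q IHq] u /=; first by rewrite addbF eqxx.
  case/andP=> /andP[-> uv] /IHq/andP[-> /eqP->] /=.
  by case: (u.2) (v.2) (odd _) uv => [] [] [].
have /andP[/path_adj_in/andP[pp Tp]] := coverP _ _ pP.
rewrite -lp /= => /eqP oddp; rewrite size_map -oddp; split=> //.
case: (p) lp pp => //= v q lq /andP[xv pq].
by rewrite rcons_path pq last_map -lq.
Qed.

Lemma connect_double_cover_sym T : connect_sym (double_cover T).
Proof.
by apply: sym_connect_sym => u v; rewrite /= adj_sym (andbC (T u.1)) (eq_sym u.2).
Qed.

Lemma connect_double_cover_lift T x y b : connect (adj_in T) x y ->
  connect (double_cover T) (x, b) (y, false) || connect (double_cover T) (x, b) (y, true).
Proof.
case/connectP=> p pP ->; elim: p x b pP => [|v p IHp] x b /=.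
  by case: b; rewrite connect0 ?orbT.
case/andP=> xv /(IHp _ (~~ b)) pv.
have step : double_cover T (x, b) (v, ~~ b) by rewrite /= xv; case: (b).
by case/orP: pv => /(connect_trans (connect1 step))->; rewrite ?orbT.
Qed.

Lemma bipartite_or_odd_closed_walk T :
  (exists g : G -> bool, {in T &, forall x y, adj x y -> g x != g y}) \/
  (exists c, [/\ cycle (@adj G) c, odd (size c) & all T c]).
Proof.
have [/existsP[x xx]|/existsPn no_odd] :=
    boolP [exists x, connect (double_cover T) (x, false) (x, true)].
  by right; apply: double_cover_odd_closed_walk xx.
pose r x := root (adj_in T) x.
left; exists (fun x => connect (double_cover T) (r x, false) (x, false)) => x y.
rewrite -!topredE /= => Tx Ty xy.
have -> : r y = r x.
  apply/esym/(rootP (connect_adj_in_sym T)); apply: connect1.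
  by rewrite /= xy Tx.
have : double_cover T (x, true) (y, false) by rewrite /= xy Tx Ty.
move/(same_connect1r (connect_double_cover_sym T)) => <-.
have /(connect_double_cover_lift false) : connect (adj_in T) (r x) x.
  by rewrite connect_adj_in_sym connect_root.
have : ~~ (connect (double_cover T) (r x, false) (x, false)
           && connect (double_cover T) (r x, false) (x, true)).
  apply/negP=> /andP[rx0 rx1]; have := no_odd x.
  by rewrite (connect_trans _ rx1) // connect_double_cover_sym.
by case: (connect _ _ (x, false)) (connect _ _ (x, true)) => [] [].
Qed.

End ClosedWalks.

(** * Induced paths *)

Section InducedPaths.
Variable G : sgraph.
Implicit Types (s c p q : seq G) (x y h : G).

Lemma sorted_rev s : sorted (@adj G) (rev s) = sorted (@adj G) s.
Proof. by rewrite rev_sorted; apply: eq_sorted => x y; rewrite adj_sym. Qed.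

Lemma on_path_edge_rev s x y : on_path_edge (rev s) x y = on_path_edge s x y.
Proof. by rewrite /on_path_edge -!infix_revLR /rev /= orbC. Qed.

Lemma on_path_edge_sym s x y : on_path_edge s x y = on_path_edge s y x.
Proof. exact: orbC. Qed.

Lemma on_path_edge_infix s1 s2 x y :
  infix s1 s2 -> on_path_edge s1 x y -> on_path_edge s2 x y.
Proof. by move=> s12 /orP[] xy; apply/orP; [left|right]; apply: infix_trans xy s12. Qed.

Lemma on_path_edge_mem s x y : on_path_edge s x y -> (x \in s) && (y \in s).
Proof. by case/orP=> /infix_mem2 // /andP[-> ->]. Qed.

Lemma infix_cat2 s1 s2 x y : infix [:: x; y] (rcons s1 x ++ y :: s2).
Proof. by rewrite cat_rcons; apply/infixP; exists s1, s2. Qed.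

Lemma infix2_split s1 s2 u x y :
  infix [:: x; y] (s1 ++ u :: s2) ->
  infix [:: x; y] (rcons s1 u) || infix [:: x; y] (u :: s2).
Proof.
elim: s1 => [->|v s1 IHs]; first by rewrite orbT.
rewrite cat_cons rcons_cons !(infix_consl _ v) => /orP[xy|/IHs/orP[]->]; rewrite ?orbT //.
suff -> : prefix [:: x; y] (v :: rcons s1 u) by [].
move: xy; rewrite !prefix_cons => /andP[->].
by case: s1 {IHs} => [|w s1] /=; rewrite ?prefix_cons ?prefix0s.
Qed.

Lemma on_path_edge_split s1 s2 u x y :
  on_path_edge (s1 ++ u :: s2) x y ->
  on_path_edge (rcons s1 u) x y || on_path_edge (u :: s2) x y.
Proof. by case/orP=> /infix2_split/orP[]; rewrite /on_path_edge => ->; rewrite ?orbT. Qed.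

Lemma infix_next h c x y :
  uniq (h :: c) -> infix [:: x; y] (rcons (h :: c) h) -> y = next (h :: c) x.
Proof.
move=> uc /infixP[s1 [s2 cE]]; rewrite rcons_cons in cE.
case/lastP: s2 cE => [|s2 v] cE.
  have /rcons_inj[cE1 yh] : rcons (h :: c) h = rcons (rcons s1 x) y.
    by rewrite rcons_cons cE -!cats1 -catA.
  rewrite -(next_rot (size s1) uc) cE1 -cats1 rot_size_cat /= -yh.
  by case: s1 cE1 {cE} => [|v s1] [-> _] /=; rewrite eqxx.
have /rcons_inj[cE1 _] : rcons (h :: c) h = rcons (s1 ++ x :: y :: s2) v.
  by rewrite rcons_cons cE -!cats1 -!catA.
by rewrite -(next_rot (size s1) uc) cE1 rot_size_cat /= eqxx.
Qed.

Definition induced_path s : Prop :=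
  [/\ uniq s, sorted (@adj G) s & {in s &, forall x y, adj x y -> on_path_edge s x y}].

Lemma induced_path1 x : induced_path [:: x].
Proof. by split=> // y z; rewrite !inE => /eqP-> /eqP->; rewrite adj_irrefl. Qed.

Lemma induced_path_rev s : induced_path s -> induced_path (rev s).
Proof.
case=> us ss es; split; rewrite ?rev_uniq ?sorted_rev // => x y.
by rewrite !mem_rev on_path_edge_rev; apply: es.
Qed.

Lemma chordless_on_path_edge h c :
    uniq (h :: c) ->
    {in h :: c &, forall x y, adj x y -> on_path_edge (rcons (h :: c) h) x y} ->
  chordless (h :: c).
Proof.
move=> uc ec x y xc yc xy.
by case/orP: (ec x y xc yc xy) => /(infix_next uc); [left|right].
Qed.

Lemma chordless_rot n c : uniq c -> chordless c -> chordless (rot n c).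
Proof. by move=> uc chord x y; rewrite !mem_rot !next_rot //; apply: chord. Qed.

Lemma is_cycle_rot n c : is_cycle (rot n c) = is_cycle c.
Proof. by rewrite /is_cycle size_rot rot_uniq rot_cycle. Qed.

Lemma induced_paths_chordless_cycle x p y q :
    induced_path (x :: p) -> induced_path (y :: q) -> 0 < size p + size q ->
    {in x :: p, forall v, v \notin y :: q} ->
    adj (last x p) y -> adj (last y q) x ->
    {in x :: p & y :: q, forall v w, adj v w ->
      (v = last x p /\ w = y) \/ (v = x /\ w = last y q)} ->
  is_cycle (x :: p ++ y :: q) /\ chordless (x :: p ++ y :: q).
Proof.
move=> [up sp ep] [uq sq eq] sz dis join_py join_qx cross.
set c := x :: p ++ y :: q.
have uc : uniq c.
  rewrite /c -cat_cons cat_uniq up uq andbT; apply/hasPn=> w wq; apply/negP=> /dis.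
  by rewrite wq.
have infix_p : infix (x :: p) (rcons c x) by rewrite /c -cat_cons rcons_cat prefix_infix.
have infix_q : infix (y :: q) (rcons c x).
  by rewrite /c -cat_cons rcons_cat -cats1 infix_infix.
have crossE v w : v \in x :: p -> w \in y :: q -> adj v w -> on_path_edge (rcons c x) v w.
  move=> vp wq vw; apply/orP; case: (cross v w vp wq vw) => [] [-> ->]; [left|right].
    rewrite /c -cat_cons rcons_cat rcons_cons (lastI x p); exact: infix_cat2.
  rewrite /c -cat_cons [y :: q]lastI -rcons_cat -(cats1 _ x).
  exact: infix_cat2.
split.
  rewrite /is_cycle uc /c /= size_cat /= addnS !ltnS sz rcons_cat cat_path /=.
  by move: sp sq join_py join_qx => /= -> sq ->; rewrite rcons_path sq.
apply: chordless_on_path_edge => // v w; rewrite -cat_cons !mem_cat.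
case/orP=> vi /orP[] wi vw.
- by apply: on_path_edge_infix infix_p _; apply: ep.
- exact: crossE.
- by rewrite on_path_edge_sym crossE // adj_sym.
- by apply: on_path_edge_infix infix_q _; apply: eq.
Qed.

Section ShortestLink.
Variables D A B : pred G.

Definition link x p : bool :=
  [&& path (@adj G) x p, all D (x :: p), A x & B (last x p)].

Definition shorter_link x p : Prop := exists y q, link y q && (size q < size p).

Lemma link_shortcut x p s1 u s2 v s3 :
    link x p -> x :: p = s1 ++ u :: s2 ++ v :: s3 -> adj u v -> 0 < size s2 ->
  shorter_link x p.
Proof.
rewrite /shorter_link /link => + + uv s2_gt0.
case: s1 => [|y s1] => lk [xE pE]; move: lk; rewrite {x}xE {p}pE.
  case/and4P=> + + Au; rewrite cat_path last_cat /= all_cat /= => /and3P[_ _ p3].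
  case/and4P=> Du _ Dv D3 Bv; exists u, (v :: s3).
  by rewrite /= uv p3 Bv Du Dv D3 Au size_cat /=; lia.
case/and4P=> + + Ay; rewrite cat_path last_cat /= cat_path last_cat /= !all_cat /=.
rewrite all_cat /= => /and3P[p1 e1 /and3P[_ _ p3]] /and4P[Dy D1 Du /and3P[_ Dv D3]] Bv.
exists y, (s1 ++ u :: v :: s3).
rewrite cat_path last_cat /= all_cat /= p1 e1 uv p3 Dy D1 Du Dv D3 Ay Bv /=.
by rewrite !size_cat /= size_cat /=; clear -s2_gt0; lia.
Qed.

Lemma link_not_uniq x p : link x p -> ~~ uniq (x :: p) -> shorter_link x p.
Proof.
case/and4P=> pp Dp Ax Bp dup; have [uxp | nuxp] := boolP (uniq (x :: p)).
  by rewrite uxp in dup.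
move: Bp; case/shortenP: pp => q pq uq sub_qp Bq; exists x, q; apply/andP; split.
  apply/and4P; split=> //; apply/allP=> v; rewrite inE => /orP[/eqP->|/sub_qp vp].
    by case/andP: Dp.
  by apply: (allP Dp); rewrite inE vp orbT.
have : size (x :: q) <= size (x :: p).
  by apply: uniq_leq_size => // v; rewrite !inE => /orP[->//|/sub_qp->]; rewrite orbT.
rewrite leq_eqVlt => /orP[/eqP size_eq|//]; case/negP: nuxp.
have sub : {subset x :: q <= x :: p}.
  by move=> v; rewrite !inE => /orP[->//|/sub_qp->]; rewrite orbT.
by rewrite (leq_size_uniq uq sub) // size_eq.
Qed.

Lemma link_extra_start x p v : link x p -> v \in p -> A v -> shorter_link x p.
Proof.
move=> lk /mem_split[s1 [s2 pE]] Av; move: lk; rewrite {p}pE => /and4P[+ + _].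
rewrite cat_path last_cat /= all_cat /= => /and3P[_ _ pv] /and4P[_ _ Dv D2] Bv.
exists v, s2; rewrite /link /= pv Dv D2 Av Bv size_cat /=; lia.
Qed.

Lemma link_extra_end x p v :
  link x p -> v \in x :: p -> B v -> v != last x p -> shorter_link x p.
Proof.
case/and4P=> pp Dp Ax _; rewrite inE => /orP[/eqP-> Bx|/mem_split[s1 [s2 pE]] Bv].
  case: p pp Dp => [|y p] _ /andP[Dx _]; rewrite /= ?eqxx // => _.
  by exists x, [::]; rewrite /link /= Dx Ax Bx.
rewrite {p}pE in pp Dp *; rewrite last_cat /= => v_last.
have s2_gt0 : 0 < size s2 by case: (s2) v_last => //; rewrite eqxx.
exists x, (rcons s1 v); rewrite /link last_rcons size_rcons size_cat /= Ax Bv /=.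
move: pp Dp; rewrite -cat_rcons cat_path /= all_cat => /andP[-> _].
by case/and3P=> -> -> _; lia.
Qed.

Definition induced_link x p : Prop :=
  [/\ induced_path (x :: p), all D (x :: p),
      A x /\ {in x :: p, forall v, A v -> v = x} &
      B (last x p) /\ {in x :: p, forall v, B v -> v = last x p}].

Lemma shortest_link x p : link x p -> exists y q, induced_link y q.
Proof.
have [n] := ubnP (size p); elim: n x p => // n IHn x p le_pn lk.
have shorten : shorter_link x p -> exists y q, induced_link y q.
  case=> y [q /andP[lk' lt_qp]]; exact: IHn (leq_trans lt_qp le_pn) lk'.
have [uxp|] := boolP (uniq (x :: p)); last by move/(link_not_uniq lk)/shorten.
have [/hasP[v vp Av]|/hasPn onlyA] := boolP (has A p).
  exact/shorten/(link_extra_start lk vp Av).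
have [/hasP[v vp /andP[Bv v_last]]|/hasPn onlyB] :=
    boolP (has (fun v => B v && (v != last x p)) (x :: p)).
  exact/shorten/(link_extra_end lk vp Bv v_last).
have [/hasP[u up /hasP[v vp /andP[uv not_edge]]]|/hasPn no_chord] := boolP
    (has (fun u => has (fun v => adj u v && ~~ on_path_edge (x :: p) u v) (x :: p)) (x :: p)).
  wlog [s1 [s2 [s3 pE]]] : u v up vp uv not_edge /
      exists s1 s2 s3, x :: p = s1 ++ u :: s2 ++ v :: s3.
    move=> chord; have [s1 [s2 pE]] := mem_split up.
    move: (vp); rewrite pE mem_cat inE => /or3P[/mem_split[t1 [t2 s1E]]|/eqP vu|].
    - apply: (chord v u) => //; rewrite 1?adj_sym 1?on_path_edge_sym //.
      by exists t1, t2, s2; rewrite pE s1E -catA.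
    - by rewrite vu adj_irrefl in uv.
    - case/mem_split=> t1 [t2 s2E]; apply: (chord u v) => //.
      by exists s1, t1, t2; rewrite pE s2E.
  apply/shorten/(link_shortcut lk pE uv).
  case: s2 pE not_edge => // ->.
  by rewrite /on_path_edge -[u :: v :: s3]/([:: u; v] ++ s3) infix_infix.
have [pp Dp Ax Bp] := and4P lk; exists x, p; split=> //.
- split=> // u v up vp uv; have /hasPn/(_ v vp) := no_chord u up.
  by rewrite uv negbK.
- by split=> // v; rewrite inE => /orP[/eqP//|/onlyA/negP].
- by split=> // v vp Bv; have := onlyB v vp; rewrite Bv negbK => /eqP.
Qed.

End ShortestLink.

End InducedPaths.

(** * Star cutsets *)

Lemma sorted_const (T : eqType) (e : rel T) (P : pred T) (s : seq T) :
    sorted e s -> {in s &, forall x y, e x y -> P x = P y} ->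
  {in s &, forall x y, P x = P y}.
Proof.
case: s => // h s; elim: s h => [|h' s IHs] h /=.
  by move=> _ _ x y; rewrite !inE => /eqP-> /eqP->.
case/andP=> hh' sorted_s step.
have const_s : {in h' :: s &, forall x y, P x = P y}.
  by apply: IHs => // x y xs ys; apply: step; rewrite inE ?xs ?ys orbT.
have h's : h' \in h' :: s by apply: mem_head.
have Ph : P h = P h' by apply: step; rewrite ?inE ?eqxx ?orbT.
have all_h' x : x \in h :: h' :: s -> P x = P h'.
  by rewrite inE => /orP[/eqP->//|xs]; apply: const_s.
by move=> x y /all_h'-> /all_h'->.
Qed.

Lemma cycle_one_side (T : eqType) (e : rel T) (N F : pred T) (c : seq T) :
    cycle e c -> uniq c -> {in c &, forall x y, N x -> N y -> x = y} ->
    {in c &, forall x y, e x y -> ~~ N x -> ~~ N y -> F x = F y} ->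
  {in c, forall x, ~~ N x -> F x} \/ {in c, forall x, ~~ N x -> ~~ F x}.
Proof.
move=> cyc uc oneN constF.
have [s [sorted_s s_c c_s]] : exists s, [/\ sorted e s,
    {in s, forall x, (x \in c) && ~~ N x} & {in c, forall x, ~~ N x -> x \in s}].
  have [/hasP[n nc Nn]|/hasPn noN] := boolP (has N c); last first.
    exists c; split=> // [|x xc]; last by rewrite xc noN.
    by move: cyc; case: (c) => //= h s; rewrite rcons_path => /andP[].
  have [i s rotE] := rot_to nc; exists s.
  have memE : c =i n :: s by move=> x; rewrite -rotE mem_rot.
  move: cyc uc; rewrite -(rot_cycle i) -(rot_uniq i) rotE => cyc uns; split=> [|x xs|x].
  - by move: cyc; rewrite /= rcons_path => /andP[/path_sorted].
  - have xc : x \in c by rewrite memE inE xs orbT.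
    rewrite xc; apply/negP=> Nx; move: uns.
    by rewrite (oneN n x nc xc Nn Nx) /= xs.
  - by rewrite memE inE => /orP[/eqP->|//]; rewrite Nn.
have const_s : {in s &, forall x y, F x = F y}.
  apply: sorted_const sorted_s _ => x y /s_c/andP[xc Nx] /s_c/andP[yc Ny] xy.
  exact: constF.
case: (s) const_s c_s => [|h t] const_s c_s; first by left=> x xc /(c_s x xc).
case Fh: (F h); [left|right] => x xc /(c_s x xc) xs;
  by rewrite (const_s x h) ?Fh ?mem_head.
Qed.

Lemma odd_cycle_not_2colored (T : eqType) (g : T -> bool) (c : seq T) :
  cycle (fun x y => g x != g y) c -> ~~ odd (size c).
Proof.
case: c => // x c.
have alternate s y : path (fun x y => g x != g y) y s -> g (last y s) = g y (+) odd (size s).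
  elim: s y => /= [|z s IHs] y; first by rewrite addbF.
  by case/andP=> yz /IHs->; move: yz; case: (g y) (g z) => [] []; case: odd.
by move=> /alternate; rewrite last_rcons size_rcons /=; case: (g x); case: (odd _).
Qed.

Lemma odd_cycle_uses_all_3colors (T : eqType) (f : T -> 'I_3) (c : seq T) (k : 'I_3) :
    cycle (fun x y => f x != f y) c -> odd (size c) ->
  exists2 x, x \in c & f x = k.
Proof.
move=> cyc oddc; have [/hasP[x xc /eqP]|/hasPn no_k] := boolP (has (fun x => f x == k) c).
  by exists x.
have two_left (a b : 'I_3) : a != k -> b != k -> a != b -> (a == ordS k) != (b == ordS k).
  by case: k a b {no_k} => [[|[|[|//]]] ?] [[|[|[|//]]] ?] [[|[|[|//]]] ?].
have /odd_cycle_not_2colored/negP[] : cycle (fun x y => (f x == ordS k) != (f y == ordS k)) c.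
  apply: (sub_in_cycle (P := mem c)) cyc; last exact/allP.
  by move=> x y /no_k xk /no_k yk; apply: two_left.
exact: oddc.
Qed.

Lemma odd_chordless_cycle_off_stable (G : sgraph) (T : pred G) :
    (forall f : G -> 'I_3, ~ proper_on predT f) ->
    (forall x y, ~~ T x -> ~~ T y -> ~~ adj x y) ->
  exists c, [/\ is_cycle c, odd (size c), chordless c & all T c].
Proof.
move=> uncol stable; have [[g gP]|[w [cyc oddw Tw]]] := bipartite_or_odd_closed_walk T.
  pose f x : 'I_3 := inord (if T x then (g x).+1 else 0).
  case: (uncol f) => x y _ _ xy; rewrite -val_eqE /f.
  have lt3 v : (if T v then (g v).+1 else 0) < 3 by case: ifP => // _; case: (g v).
  rewrite /= !inordK //.
  have [Tx|Tx] := boolP (T x); have [Ty|Ty] := boolP (T y) => //.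
    by have := gP x y Tx Ty xy; case: (g x) (g y) => [] [].
  by have := stable x y Tx Ty; rewrite xy.
have [c [cycc oddc chc sub_cw]] := odd_closed_walk_chordless_cycle cyc oddw.
by exists c; split=> //; apply/allP=> x /sub_cw/(allP Tw).
Qed.

Lemma critical4_3coloring_off_rooted (G : sgraph) (v x : G) (k : 'I_3) :
  vertex_critical4 G -> exists2 f : G -> 'I_3, proper_on (predC1 v) f & f x = k.
Proof.
move=> /(critical4_3coloring_off v)[f fP]; exists (tperm (f x) k \o f); last exact: tpermL.
by move=> y z yv zv yz; rewrite /= (inj_eq perm_inj) fP.
Qed.

Definition at_most_one_neighbour (G : sgraph) (x : G) (s : seq G) : Prop :=
  {in s &, forall y z, adj x y -> adj x z -> y = z}.

Lemma short_cycle_at_most_one_neighbour (G : sgraph) g (c : seq G) (x : G) :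
    (forall d : seq G, is_cycle d -> g <= size d) -> is_cycle c -> size c + 4 < 2 * g ->
  x \notin c -> at_most_one_neighbour x c.
Proof.
move=> girth_ge /and3P[_ uc cyc] short xc y z yc zc xy xz.
apply/eqP/negPn/negP => yz.
have [i s rotE] := rot_to yc.
have /mem_split[s1 [s2 sE]] : z \in s.
  by move: zc; rewrite -(mem_rot i) rotE inE eq_sym (negbTE yz).
move: uc cyc xc short; rewrite -(rot_uniq i) -(rot_cycle i) -(mem_rot i) -(size_rot i).
rewrite rotE {s rotE}sE => uc cyc xc short.
have /= := cyc; rewrite rcons_cat cat_path /= => /and3P[path1 e1 path2].
have /girth_ge : is_cycle (x :: y :: rcons s1 z).
  apply/and3P; split; first by rewrite /= size_rcons.
    move: uc xc; rewrite -cat_rcons -cat_cons cat_uniq mem_cat negb_or.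
    by case/andP=> uys _ /andP[xys _]; rewrite cons_uniq xys uys.
  by rewrite /= xy !rcons_path last_rcons path1 e1 adj_sym xz.
have /girth_ge : is_cycle (x :: z :: rcons s2 y).
  apply/and3P; split; first by rewrite /= size_rcons.
    have pe : perm_eq (z :: rcons s2 y) (y :: z :: s2) by rewrite -rcons_cons perm_rcons.
    have sub : subseq (y :: z :: s2) (y :: s1 ++ z :: s2) by rewrite /= eqxx suffix_subseq.
    rewrite cons_uniq (perm_uniq pe) (perm_mem pe) (subseq_uniq sub uc) andbT.
    by apply: contra xc; apply: mem_subseq.
  by rewrite /= xz rcons_path last_rcons path2 adj_sym xy.
by move: short; rewrite /= !size_rcons size_cat /=; clear; lia.
Qed.

Definition one_odd_hole_length l (G : sgraph) : Prop :=
  (forall c : seq G, is_cycle c -> 2 * l + 1 <= size c) /\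
  (forall c : seq G, odd_hole c -> ~~ (2 * l + 3 <= size c)).

Definition hole_length l n : bool := (2 * l + 1 <= n) && (odd n ==> (n == 2 * l + 1)).

Section OneOddHoleLength.
Variables (l : nat) (G : sgraph).
Hypotheses (l_ge2 : 2 <= l) (oneG : one_odd_hole_length l G).
Implicit Types (c : seq G) (x y z : G).

Lemma chordless_cycle_length c : is_cycle c -> chordless c -> hole_length l (size c).
Proof.
have [girth_ge no_long] := oneG; move=> cyc chord; have ge := girth_ge c cyc.
rewrite /hole_length ge; apply/implyP=> oddc.
suff /no_long : odd_hole c by lia.
by split=> //; split=> //; lia.
Qed.

Lemma odd_cycle_at_most_one_neighbour c x :
  is_cycle c -> size c = 2 * l + 1 -> x \notin c -> at_most_one_neighbour x c.
Proof.
move=> cyc size_c; have [girth_ge _] := oneG.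
by apply: short_cycle_at_most_one_neighbour girth_ge cyc _; rewrite size_c; lia.
Qed.

Lemma triangle_free x y z : adj x y -> adj y z -> ~~ adj x z.
Proof.
move=> xy yz; apply/negP=> xz; have [girth_ge _] := oneG.
have neq (u v : G) : adj u v -> u != v by apply: contraTneq => ->; rewrite adj_irrefl.
have /girth_ge : is_cycle [:: x; y; z].
  by rewrite /is_cycle /= !inE negb_or xy yz (adj_sym z) xz !neq.
by rewrite /=; lia.
Qed.

Section StarSides.
Variables (F : pred G) (x : G).
Hypothesis F_off_star : forall v, F v -> (v != x) && ~~ adj x v.
Hypothesis F_boundary : forall u v, F u -> adj u v -> [|| F v, v == x | adj x v].

Lemma star_side_odd_cycle c :
    is_cycle c -> size c = 2 * l + 1 -> x \notin c ->
  {in c, forall v, F v || adj x v} \/ {in c, forall v, ~~ F v}.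
Proof.
move=> cyc size_c xc; have [_ uc cycle_c] := and3P cyc.
have off_x v : v \in c -> v != x by move=> vc; apply: contraNneq xc => <-.
case: (@cycle_one_side _ (@adj G) (adj x) F c cycle_c uc).
- exact: odd_cycle_at_most_one_neighbour.
- move=> u v u_c v_c uv xu xv; apply/idP/idP=> /F_boundary.
    by move/(_ _ uv); rewrite (negbTE (off_x v v_c)) (negbTE xv) !orbF.
  by rewrite adj_sym in uv => /(_ _ uv); rewrite (negbTE (off_x u u_c)) (negbTE xu) !orbF.
- by move=> inF; left=> v vc; have [|/(inF v vc)->] := boolP (adj x v); rewrite ?orbT.
- move=> offF; right=> v vc; have [xv|/(offF v vc)//] := boolP (adj x v).
  by apply/negP=> /F_off_star; rewrite xv andbF.
Qed.

Variables f1 f2 : G -> 'I_3.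
Hypothesis f1P : proper_on [pred v | [|| F v, v == x | adj x v]] f1.
Hypothesis f2P : proper_on [pred v | ~~ F v] f2.
Hypothesis f12x : f1 x = f2 x.

Lemma star_color_class_stable u v :
    (if F u then f1 u else f2 u) = f1 x -> (if F v then f1 v else f2 v) = f1 x ->
  ~~ adj u v.
Proof.
have Fx : ~~ F x by apply/negP=> /F_off_star; rewrite eqxx.
have crossing u' v' : F u' -> ~~ F v' -> f2 v' = f1 x -> ~~ adj u' v'.
  move=> Fu Fv f2v; apply/negP=> uv; have := F_boundary Fu uv.
  rewrite (negbTE Fv) /= => /orP[/eqP v'x|xv].
    by have /andP[_] := F_off_star Fu; rewrite adj_sym -v'x uv.
  by have := f2P Fx Fv xv; rewrite f2v f12x eqxx.
case: ifP => Fu fu; case: ifP => Fv fv.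
- by apply/negP=> /f1P; rewrite !inE Fu Fv fu fv eqxx => /(_ isT isT).
- by apply: crossing => //; rewrite Fv.
- by rewrite adj_sym; apply: crossing => //; rewrite Fu.
- by apply/negP=> /f2P; rewrite !inE Fu Fv fu fv eqxx => /(_ isT isT).
Qed.

(* The vertices not coloured like [x] contain an odd hole; as it meets the neighbourhood
   of [x] at most once, it lies on one side, where only two colours are left for it. *)
Lemma star_sides_not_uncolorable : ~ (forall f : G -> 'I_3, ~ proper_on predT f).
Proof.
pose T v := (if F v then f1 v else f2 v) != f1 x.
case/(@odd_chordless_cycle_off_stable _ T) => [u v|d [cyc oddd chord /allP Td]].
  by rewrite !negbK => /eqP fu /eqP fv; apply: star_color_class_stable.
have Fx : ~~ F x by apply/negP=> /F_off_star; rewrite eqxx.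
have xd : x \notin d by apply/negP=> /Td; rewrite /T (negbTE Fx) f12x eqxx.
have size_d : size d = 2 * l + 1.
  by have /andP[_ /implyP/(_ oddd)/eqP] := chordless_cycle_length cyc chord.
have [_ _ cycle_d] := and3P cyc.
case: (star_side_odd_cycle cyc size_d xd) => side.
  have [v vd fv] : exists2 v, v \in d & f1 v = f1 x.
    apply: odd_cycle_uses_all_3colors oddd.
    apply: (sub_in_cycle (P := mem d)) cycle_d; last exact/allP.
    move=> u v /side Fu /side Fv; apply: f1P; rewrite !inE.
      by case/orP: Fu => ->; rewrite ?orbT.
    by case/orP: Fv => ->; rewrite ?orbT.
  case/orP: (side v vd) => [Fv|xv]; first by have := Td v vd; rewrite /T Fv fv eqxx.
  by have := @f1P x v; rewrite !inE eqxx xv fv eqxx !orbT => /(_ isT isT isT).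
have [v vd fv] : exists2 v, v \in d & f2 v = f1 x.
  apply: odd_cycle_uses_all_3colors oddd.
  apply: (sub_in_cycle (P := mem d)) cycle_d; last exact/allP.
  by move=> u v /side Fu /side Fv; apply: f2P.
by have := Td v vd; rewrite /T (negbTE (side v vd)) fv eqxx.
Qed.

End StarSides.

Lemma no_star_cutset (F : pred G) x y z :
    vertex_critical4 G -> F y -> ~~ F z -> z != x -> ~~ adj x z ->
    (forall v, F v -> (v != x) && ~~ adj x v) ->
    (forall u v, F u -> adj u v -> [|| F v, v == x | adj x v]) ->
  False.
Proof.
move=> crit Fy Fz zx xz F_off F_bd.
have [f1 f1P f1x] := critical4_3coloring_off_rooted z x ord0 crit.
have [f2 f2P f2x] := critical4_3coloring_off_rooted y x ord0 crit.
apply: (@star_sides_not_uncolorable F x F_off F_bd f1 f2); last first.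
- by move=> f; apply: critical4_not_3colorable crit.
- by rewrite f1x.
- by move=> u v Fu Fv; apply: f2P; rewrite inE; [apply: contraNneq Fu|apply: contraNneq Fv] => ->.
move=> u v; have neq_z w : [|| F w, w == x | adj x w] -> w != z.
  case/or3P=> [Fw|/eqP->|xw]; last by apply: contraNneq xz => <-.
    by apply: contraNneq Fz => <-.
  by rewrite eq_sym.
by move=> /neq_z uz /neq_z vz; apply: f1P.
Qed.

End OneOddHoleLength.

(** * Skeletons and routes *)

Lemma infix2_rcons_mem (T : eqType) (s : seq T) x y z :
  infix [:: x; y] (rcons s z) -> x \in s.
Proof.
case/infixP=> t1 [t2 sE].
have /rcons_inj[-> _] : rcons s z = rcons (t1 ++ x :: belast y t2) (last y t2).
  by rewrite sE -cats1 -catA /= cats1 -lastI.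
by rewrite mem_cat mem_head orbT.
Qed.

Lemma on_path_edge_interior (G : sgraph) (s : seq G) a b x y :
  0 < size s -> on_path_edge (a :: rcons s b) x y -> (x \in s) || (y \in s).
Proof.
have half u v : 0 < size s -> infix [:: u; v] (a :: rcons s b) -> (u \in s) || (v \in s).
  move=> s_gt0; rewrite infix_consl => /orP[|/infix2_rcons_mem->//].
  by case: s s_gt0 => //= c s _ /and3P[_ /eqP-> _]; rewrite mem_head orbT.
by move=> s_gt0 /orP[]/(half _ _ s_gt0) //; rewrite orbC.
Qed.

Lemma uniq_flatten_nth (T : eqType) (ss : seq (seq T)) i j x :
  uniq (flatten ss) -> x \in nth [::] ss i -> x \in nth [::] ss j -> i = j.
Proof.
have in_flatten (tt : seq (seq T)) k : x \in nth [::] tt k -> x \in flatten tt.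
  have [lt_k|le_k] := ltnP k (size tt); last by rewrite nth_default.
  by move=> xk; apply/flattenP; exists (nth [::] tt k) => //; apply: mem_nth.
elim: ss i j => [|s ss IHs] [|i] [|j] //=; rewrite cat_uniq => /and3P[_ /hasPn dis u].
- by move=> xs /in_flatten/dis; rewrite /= xs.
- by move=> /in_flatten/dis/negP xs /xs.
- by move=> xi xj; rewrite (IHs i j).
Qed.

Section Skeleton.
Variables (G : sgraph) (x0 : G).

(* A segment [(i, j, s)] joins the nodes number [i] and [j] and has the interior
   vertices [s], listed from [i] to [j]. *)
Definition segment : Type := nat * nat * seq G.
Implicit Types (p q nd : seq G) (sg : seq segment) (i j k m : nat) (r : seq nat).

Definition seg_at sg k : segment := nth (0, 0, [::]) sg k.

Definition seg_vertices nd (t : segment) : seq G :=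
  nth x0 nd t.1.1 :: rcons t.2 (nth x0 nd t.1.2).

Definition skel_vertices nd sg : seq G := nd ++ flatten [seq s.2 | s <- sg].

Definition skeleton (U : {pred G}) nd sg : Prop :=
  [/\ uniq (skel_vertices nd sg) /\ skel_vertices nd sg =i U,
      {in sg, forall s, (s.1.1 < size nd) && (s.1.2 < size nd)},
      {in sg, forall s, sorted (@adj G) (seg_vertices nd s)} &
      {in U &, forall x y, adj x y ->
        exists2 s, s \in sg & on_path_edge (seg_vertices nd s) x y}].

Definition incident i (t : segment) : bool := (t.1.1 == i) || (t.1.2 == i).

Definition subdivide k m p q sg : seq segment :=
  let s := seg_at sg k in
  take k sg ++ (s.1.1, m, p) :: (m, s.1.2, q) :: drop k.+1 sg.

Lemma split_at_segment sg k :
  k < size sg -> sg = take k sg ++ seg_at sg k :: drop k.+1 sg.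
Proof. by move=> lt_k; rewrite -drop_nth // cat_take_drop. Qed.

Lemma skel_vertices_subdivide nd sg k p y q :
    k < size sg -> (seg_at sg k).2 = p ++ y :: q ->
  perm_eq (skel_vertices (rcons nd y) (subdivide k (size nd) p q sg))
          (skel_vertices nd sg).
Proof.
move=> lt_k sE; rewrite [X in skel_vertices nd X](split_at_segment lt_k).
apply/seq.permP=> P.
rewrite /skel_vertices /subdivide !map_cat !flatten_cat /= sE -cats1.
by rewrite !(count_cat, catA) /=; lia.
Qed.

Lemma mem_subdivide k m p q sg s : k < size sg ->
  s \in sg -> s = seg_at sg k \/ s \in subdivide k m p q sg.
Proof.
move=> lt_k; rewrite {1}(split_at_segment lt_k) !(mem_cat, inE).
by case/or3P=> [->|/eqP->|->]; [right|left|right; rewrite ?orbT].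
Qed.

Lemma subdivide_mem k m p q sg s : s \in subdivide k m p q sg ->
  [\/ s \in sg, s = ((seg_at sg k).1.1, m, p) | s = (m, (seg_at sg k).1.2, q)].
Proof.
rewrite mem_cat !inE => /or4P[/mem_take|/eqP->|/eqP->|/mem_drop].
- by constructor 1.
- by constructor 2.
- by constructor 3.
- by constructor 1.
Qed.

Lemma skeleton_subdivide U nd sg k p y q :
    skeleton U nd sg -> k < size sg -> (seg_at sg k).2 = p ++ y :: q ->
  skeleton U (rcons nd y) (subdivide k (size nd) p q sg).
Proof.
move=> [[uV memV] ends paths edges] lt_k sE.
have permV := skel_vertices_subdivide nd lt_k sE.
have at_k : seg_at sg k \in sg by apply: mem_nth.
have /andP[lt_a lt_b] := ends _ at_k.
have old s : s \in sg -> seg_vertices (rcons nd y) s = seg_vertices nd s.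
  by case/ends/andP=> la lb; rewrite /seg_vertices !nth_rcons la lb.
have halves : seg_vertices nd (seg_at sg k) =
    (nth x0 nd (seg_at sg k).1.1 :: p) ++ y :: rcons q (nth x0 nd (seg_at sg k).1.2).
  by rewrite /seg_vertices sE rcons_cat.
have left_half : seg_vertices (rcons nd y) ((seg_at sg k).1.1, size nd, p) =
    rcons (nth x0 nd (seg_at sg k).1.1 :: p) y.
  by rewrite /seg_vertices /= !nth_rcons lt_a ltnn eqxx.
have right_half : seg_vertices (rcons nd y) (size nd, (seg_at sg k).1.2, q) =
    y :: rcons q (nth x0 nd (seg_at sg k).1.2).
  by rewrite /seg_vertices /= !nth_rcons lt_b ltnn eqxx.
split.
- by rewrite (perm_uniq permV); split=> // x; rewrite (perm_mem permV).
- move=> s /subdivide_mem[/ends/andP[la lb]|->|->] /=; rewrite size_rcons !ltnS ?leqnn ?andbT.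
  + by rewrite (ltnW la) (ltnW lb).
  + exact: ltnW.
  + exact: ltnW.
- have := paths _ at_k; rewrite halves => sorted_k s /subdivide_mem[sin|->|->].
  + by rewrite old //; apply: paths.
  + by rewrite left_half; move: sorted_k; rewrite -cat_rcons => /cat_sorted2[].
  + by rewrite right_half; move: sorted_k => /cat_sorted2[].
move=> u v uU vU uv; have [s sin e] := edges u v uU vU uv.
have [sk|s_old] := mem_subdivide (size nd) p q lt_k sin; last by exists s; rewrite ?old.
move: e; rewrite sk halves => /on_path_edge_split/orP[] e.
  by exists ((seg_at sg k).1.1, size nd, p); rewrite ?left_half // mem_cat mem_head orbT.
by exists (size nd, (seg_at sg k).1.2, q); rewrite ?right_half // mem_cat !inE eqxx !orbT.
Qed.

(* A route is given by the numbers of the nodes that it visits. Everything about it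
   but the sizes of the segments is computed from these numbers. *)
Definition joins i j (t : segment) : bool := (t.1 == (i, j)) || (t.1 == (j, i)).

Definition linked sg i j : bool := has (joins i j) sg.

Definition seg_index sg i j : nat := find (joins i j) sg.

Definition interior sg i j : seq G :=
  let s := seg_at sg (seg_index sg i j) in if s.1 == (i, j) then s.2 else rev s.2.

Definition traversed sg i r : seq nat := pairmap (seg_index sg) i r.

Definition chordfree sg i r : bool :=
  all (fun k => [|| k \in traversed sg i r, (seg_at sg k).1.1 \notin i :: r,
                   (seg_at sg k).1.2 \notin i :: r | 0 < size (seg_at sg k).2])
      (iota 0 (size sg)).

Definition route nd sg i r : bool :=
  [&& i < size nd, path (linked sg) i r, uniq (traversed sg i r) & chordfree sg i r].

Definition open_route nd sg i r : bool := route nd sg i r && uniq (i :: r).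

Definition closed_route nd sg i r : bool :=
  [&& route nd sg i r, uniq r, last i r == i & 2 < size r].

Definition route_length sg i r : nat :=
  sumn (pairmap (fun i j => (size (seg_at sg (seg_index sg i j)).2).+1) i r).

Definition trail nd sg i r : seq G :=
  flatten (pairmap (fun i j => rcons (interior sg i j) (nth x0 nd j)) i r).

Lemma size_trail nd sg i r : size (trail nd sg i r) = route_length sg i r.
Proof.
rewrite /trail size_flatten /shape /route_length; congr sumn.
elim: r i => //= j r IHr i; rewrite IHr size_rcons /interior.
by case: ifP; rewrite ?size_rev.
Qed.

Lemma size_le_route_length sg i r : size r <= route_length sg i r.
Proof.
by elim: r i => //= j r IHr i; rewrite /route_length /= addSn ltnS (leq_trans (IHr j)) ?leq_addl.
Qed.

Lemma trail_cons nd sg i j r :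
  trail nd sg i (j :: r) = rcons (interior sg i j) (nth x0 nd j) ++ trail nd sg j r.
Proof. by []. Qed.

Lemma last_trail nd sg i r :
  last (nth x0 nd i) (trail nd sg i r) = nth x0 nd (last i r).
Proof. by elim: r i => //= j r IHr i; rewrite trail_cons last_cat last_rcons IHr. Qed.

(* [M] lists the nodes to which [w] may be adjacent: of these the route meets no
   neighbour of [w] but its last node. *)
Definition jump w nd sg M i r : bool :=
  [&& open_route nd sg i r, 0 < size r, adj w (nth x0 nd (last i r)) &
      all (fun m => (m < size nd) &&
        [|| m == last i r, m \notin i :: r | ~~ adj w (nth x0 nd m)]) M].

Section Routes.
Variables (U : {pred G}) (nd : seq G) (sg : seq segment).
Hypothesis sk : skeleton U nd sg.

Lemma node_inj i j : i < size nd -> j < size nd -> nth x0 nd i = nth x0 nd j -> i = j.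
Proof.
move=> lt_i lt_j /eqP; case: sk => -[+ _] _ _ _; rewrite cat_uniq => /and3P[und _ _].
by rewrite nth_uniq // => /eqP.
Qed.

Lemma node_in_skeleton i : i < size nd -> nth x0 nd i \in U.
Proof. by move=> lt_i; case: sk => -[_ <-] _ _ _; rewrite mem_cat mem_nth. Qed.

Lemma seg_at_mem k : k < size sg -> seg_at sg k \in sg.
Proof. exact: mem_nth. Qed.

Lemma seg_ends k : k < size sg ->
  ((seg_at sg k).1.1 < size nd) && ((seg_at sg k).1.2 < size nd).
Proof. by move/seg_at_mem; case: sk => _ ends _ _ /ends. Qed.

Lemma interior_in_skeleton k x : k < size sg -> x \in (seg_at sg k).2 -> x \in U.
Proof.
move=> lt_k xk; case: sk => -[_ <-] _ _ _; rewrite mem_cat; apply/orP; right.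
by apply/flattenP; exists (seg_at sg k).2 => //; apply/map_f/seg_at_mem.
Qed.

Lemma interior_not_node k i :
  k < size sg -> i < size nd -> nth x0 nd i \notin (seg_at sg k).2.
Proof.
move=> lt_k lt_i; case: sk => -[+ _] _ _ _; rewrite cat_uniq => /and3P[_ /hasPn dis _].
apply/negP=> node_k; have /dis/negP[] : nth x0 nd i \in flatten [seq s.2 | s <- sg].
  by apply/flattenP; exists (seg_at sg k).2 => //; apply/map_f/seg_at_mem.
exact: mem_nth.
Qed.

Lemma interior_inj k k' x :
  x \in (seg_at sg k).2 -> x \in (seg_at sg k').2 -> k = k'.
Proof.
case: sk => -[+ _] _ _ _; rewrite cat_uniq => /and3P[_ _ u].
have nthE n : (seg_at sg n).2 = nth [::] [seq s.2 | s <- sg] n.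
  have [lt_n|ge_n] := ltnP n (size sg); first by rewrite (nth_map (0, 0, [::])).
  by rewrite /seg_at !nth_default ?size_map.
by rewrite !nthE; apply: uniq_flatten_nth.
Qed.

Lemma interior_uniq k : k < size sg -> uniq (seg_at sg k).2.
Proof.
move=> lt_k; have in_k : (seg_at sg k).2 \in [seq s.2 | s <- sg] by apply/map_f/seg_at_mem.
case: sk => -[+ _] _ _ _; rewrite cat_uniq => /and3P[_ _].
elim: [seq s.2 | s <- sg] in_k => //= t tt IHt; rewrite inE cat_uniq.
by case/orP=> [/eqP->|/IHt uniq_k] /and3P[].
Qed.

Lemma node_neighbour i x : i < size nd -> x \in U -> adj (nth x0 nd i) x ->
  exists2 t, t \in sg & incident i t && on_path_edge (seg_vertices nd t) (nth x0 nd i) x.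
Proof.
move=> lt_i xU ix; case: (sk) => _ ends _ /(_ _ x (node_in_skeleton lt_i) xU ix)[t t_sg e].
exists t => //; rewrite e andbT; have /andP[lt_a lt_b] := ends t t_sg.
have /andP[] := on_path_edge_mem e; rewrite inE mem_rcons inE => + _.
case/or3P=> [/eqP/(node_inj lt_i lt_a)->|/eqP/(node_inj lt_i lt_b)->|].
- by rewrite /incident eqxx.
- by rewrite /incident eqxx orbT.
by rewrite -(nth_index (0, 0, [::]) t_sg) (negbTE (interior_not_node _ lt_i)) // index_mem.
Qed.

Lemma linked_index i j : linked sg i j ->
  seg_index sg i j < size sg /\ joins i j (seg_at sg (seg_index sg i j)).
Proof. by move=> link_ij; rewrite /seg_at /seg_index -has_find nth_find. Qed.

Lemma linked_lt i j : linked sg i j -> (i < size nd) && (j < size nd).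
Proof.
by case/linked_index=> /seg_ends + /orP[]/eqP ends; rewrite ends //= andbC.
Qed.

Lemma linked_vertices i j : linked sg i j ->
  let t := seg_vertices nd (seg_at sg (seg_index sg i j)) in
  nth x0 nd i :: rcons (interior sg i j) (nth x0 nd j) = t \/
  nth x0 nd i :: rcons (interior sg i j) (nth x0 nd j) = rev t.
Proof.
case/linked_index=> _; rewrite /joins /interior /seg_vertices; case: eqP => [->|_] /=.
  by left.
by move/eqP=> ->; right; rewrite rev_cons rev_rcons.
Qed.

Lemma mem_interior i j : interior sg i j =i (seg_at sg (seg_index sg i j)).2.
Proof. by move=> x; rewrite /interior; case: ifP; rewrite ?mem_rev. Qed.

Lemma traversed_lt i r : path (linked sg) i r -> {in traversed sg i r, forall k, k < size sg}.
Proof.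
elim: r i => //= j r IHr i /andP[/linked_index[lt_ij _] /IHr lt_r] k.
by rewrite inE => /orP[/eqP->|/lt_r].
Qed.

Lemma path_linked_lt i r : path (linked sg) i r -> {in r, forall m, m < size nd}.
Proof.
elim: r i => //= j r IHr i /andP[/linked_lt/andP[_ lt_j] /IHr lt_r] m.
by rewrite inE => /orP[/eqP->|/lt_r].
Qed.

Lemma path_trail i r : path (linked sg) i r -> path (@adj G) (nth x0 nd i) (trail nd sg i r).
Proof.
elim: r i => //= j r IHr i /andP[link_ij /IHr path_r].
rewrite trail_cons cat_path last_rcons path_r andbT.
have [lt_ij _] := linked_index link_ij.
have : sorted (@adj G) (seg_vertices nd (seg_at sg (seg_index sg i j))).
  by case: sk => _ _ paths _; apply/paths/seg_at_mem.
rewrite -[path _ _ _]/(sorted _ (_ :: _)).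
by case: (linked_vertices link_ij) => ->; rewrite ?sorted_rev.
Qed.

Lemma mem_trail i r x : x \in trail nd sg i r ->
  (exists2 m, m \in r & x = nth x0 nd m) \/
  (exists2 k, k \in traversed sg i r & x \in (seg_at sg k).2).
Proof.
elim: r i => //= j r IHr i; rewrite trail_cons mem_cat mem_rcons inE mem_interior.
case/orP=> [/orP[/eqP->|xs]|/IHr[[m mr xE]|[k kr xk]]].
- by left; exists j; rewrite ?mem_head.
- by right; exists (seg_index sg i j); rewrite ?mem_head.
- by left; exists m; rewrite ?inE ?mr ?orbT.
- by right; exists k; rewrite ?inE ?kr ?orbT.
Qed.

Lemma trail_interior_traversed i r k x : path (linked sg) i r -> k < size sg ->
  x \in (seg_at sg k).2 -> x \in trail nd sg i r -> k \in traversed sg i r.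
Proof.
move=> path_r lt_k xk /mem_trail[[m mr xE]|[k' k'r xk']]; last by rewrite (interior_inj xk xk').
by move: xk; rewrite xE (negbTE (interior_not_node _ (path_linked_lt path_r mr))).
Qed.

Lemma trail_node i r m : path (linked sg) i r -> m < size nd ->
  nth x0 nd m \in trail nd sg i r -> m \in r.
Proof.
move=> path_r lt_m /mem_trail[[m' m'r mE]|[k kr]].
  by rewrite (node_inj lt_m (path_linked_lt path_r m'r) mE).
by rewrite (negbTE (interior_not_node (traversed_lt path_r kr) lt_m)).
Qed.

Lemma trail_in_skeleton i r : path (linked sg) i r -> {subset trail nd sg i r <= U}.
Proof.
move=> path_r x /mem_trail[[m mr ->]|[k kr]].
  exact/node_in_skeleton/(path_linked_lt path_r).
exact/interior_in_skeleton/(traversed_lt path_r).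
Qed.

Lemma trail_uniq i r : path (linked sg) i r -> uniq r -> uniq (traversed sg i r) ->
  uniq (trail nd sg i r).
Proof.
elim: r i => //= j r IHr i /andP[link_ij path_r] /andP[j_r ur] /andP[ij_r ut].
have [lt_ij _] := linked_index link_ij; have /andP[_ lt_j] := linked_lt link_ij.
rewrite trail_cons cat_uniq rcons_uniq IHr // mem_interior interior_not_node //= andbT.
apply/andP; split.
  by rewrite /interior; case: ifP; rewrite ?rev_uniq interior_uniq.
apply/hasPn=> x x_r; rewrite /= mem_rcons inE negb_or mem_interior; apply/andP; split.
  by apply: contraNneq j_r => xE; apply: trail_node path_r lt_j _; rewrite -xE.
by apply: contra ij_r => x_ij; apply: trail_interior_traversed path_r lt_ij x_ij x_r.
Qed.

Lemma traversed_edge i r k x y : path (linked sg) i r -> k \in traversed sg i r ->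
    on_path_edge (seg_vertices nd (seg_at sg k)) x y ->
  on_path_edge (nth x0 nd i :: trail nd sg i r) x y.
Proof.
elim: r i => //= j r IHr i /andP[link_ij path_r]; rewrite inE trail_cons.
case/orP=> [/eqP->|kr] xy.
  rewrite -cat_cons; apply: on_path_edge_infix (prefix_infix _ _) _.
  by case: (linked_vertices link_ij) => ->; rewrite ?on_path_edge_rev.
apply: on_path_edge_infix (IHr j path_r kr xy).
by rewrite cat_rcons -cat_cons suffix_infix.
Qed.

Lemma untraversed_end i r k x : route nd sg i r -> k < size sg -> k \notin traversed sg i r ->
    x \in nth x0 nd i :: trail nd sg i r -> x \in seg_vertices nd (seg_at sg k) ->
  x \notin (seg_at sg k).2 /\
  exists2 m, m \in i :: r &
    (m \in [:: (seg_at sg k).1.1; (seg_at sg k).1.2]) && (x == nth x0 nd m).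
Proof.
case/and4P=> lt_i path_r _ _ lt_k k_r x_r; have /andP[lt_a lt_b] := seg_ends lt_k.
have visited m : m < size nd -> x = nth x0 nd m -> m \in i :: r.
  move=> lt_m xE; move: x_r; rewrite xE !inE => /orP[/eqP/(node_inj lt_m lt_i)->|].
    by rewrite eqxx.
  by move/(trail_node path_r lt_m)->; rewrite orbT.
have off_k : x \notin (seg_at sg k).2.
  apply: contra k_r => xk; move: x_r; rewrite inE => /orP[/eqP xE|].
    by move: xk; rewrite xE (negbTE (interior_not_node _ _)).
  exact: trail_interior_traversed path_r lt_k xk.
rewrite inE mem_rcons inE (negbTE off_k) orbF => x_end; split=> //.
by case/orP: x_end => /eqP xE; [exists (seg_at sg k).1.1|exists (seg_at sg k).1.2];
  rewrite ?visited // !inE xE !eqxx ?orbT.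
Qed.

Lemma trail_chordless i r x y : route nd sg i r ->
    x \in nth x0 nd i :: trail nd sg i r -> y \in nth x0 nd i :: trail nd sg i r -> adj x y ->
  on_path_edge (nth x0 nd i :: trail nd sg i r) x y.
Proof.
move=> rt xr yr xy; have /and4P[lt_i path_r _ /allP free] := rt.
have inU z : z \in nth x0 nd i :: trail nd sg i r -> z \in U.
  rewrite inE => /orP[/eqP->|]; [exact: node_in_skeleton|exact: trail_in_skeleton].
have [_ _ _ /(_ x y (inU x xr) (inU y yr) xy)[s s_in s_xy]] := sk.
have [k lt_k sE] : exists2 k, k < size sg & s = seg_at sg k.
  by exists (index s sg); rewrite ?index_mem // /seg_at nth_index.
rewrite {s s_in}sE in s_xy; have [k_r|k_r] := boolP (k \in traversed sg i r).
  exact: traversed_edge path_r k_r s_xy.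
have /andP[xk yk] := on_path_edge_mem s_xy.
have [x_off [m m_r /andP[m_k /eqP xE]]] := untraversed_end rt lt_k k_r xr xk.
have [y_off [n n_r /andP[n_k /eqP yE]]] := untraversed_end rt lt_k k_r yr yk.
have := free k; rewrite mem_iota lt_k (negbTE k_r) /= => /(_ isT).
have m_n : m != n by apply: contraTneq xy; rewrite xE yE => ->; rewrite adj_irrefl.
have /andP[a_r b_r] : ((seg_at sg k).1.1 \in i :: r) && ((seg_at sg k).1.2 \in i :: r).
  move: m_n m_k n_k m_r n_r; rewrite !inE => m_n /orP[]/eqP mE /orP[]/eqP nE.
  - by rewrite mE nE eqxx in m_n.
  - by rewrite -mE -nE => -> ->.
  - by rewrite -mE -nE => -> ->.
  - by rewrite mE nE eqxx in m_n.
case/or3P=> [a_off|b_off|/on_path_edge_interior/(_ s_xy)].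
- by rewrite a_r in a_off.
- by rewrite b_r in b_off.
- by rewrite (negbTE x_off) (negbTE y_off).
Qed.

Lemma open_route_induced i r :
  open_route nd sg i r -> induced_path (nth x0 nd i :: trail nd sg i r).
Proof.
case/andP=> rt; rewrite cons_uniq => /andP[i_r ur]; have /and4P[lt_i path_r ut _] := rt.
split; [|exact: path_trail|by move=> x y; apply: trail_chordless].
rewrite cons_uniq trail_uniq // andbT.
by apply: contra i_r; apply: trail_node path_r lt_i.
Qed.

Lemma closed_route_cycle i r :
  closed_route nd sg i r -> is_cycle (trail nd sg i r) /\ chordless (trail nd sg i r).
Proof.
case/and4P=> rt ur /eqP last_r size_r; have /and4P[_ path_r ut _] := rt.
have := last_trail nd sg i r; rewrite last_r => last_t.
have := trail_uniq path_r ur ut; have := path_trail path_r.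
have := leq_trans size_r (size_le_route_length sg i r); rewrite -(size_trail nd).
have := @trail_chordless i r; case/lastP: (trail nd sg i r) last_t => // t v.
rewrite last_rcons => ->; set w := nth x0 nd i => chordfree_t size_t path_t uniq_t.
have uniq_wt : uniq (w :: t) by move: uniq_t; rewrite rcons_uniq.
have chord_wt : chordless (w :: t).
  apply: chordless_on_path_edge => // x y xt yt; apply: chordfree_t => //;
    by rewrite -rcons_cons mem_rcons inE ?xt ?yt orbT.
rewrite -rot1_cons; split; last exact: chordless_rot.
by move: size_t; rewrite size_rcons is_cycle_rot /is_cycle uniq_wt => ->.
Qed.

Section Jumps.
Variable l : nat.
Hypotheses (l_ge2 : 2 <= l) (oneG : one_odd_hole_length l G).

Lemma closed_route_length i r :
  closed_route nd sg i r -> hole_length l (route_length sg i r).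
Proof.
case/closed_route_cycle=> cyc chord; rewrite -(size_trail nd).
exact: (chordless_cycle_length l_ge2 oneG).
Qed.

Lemma route_at_most_one_neighbour i r s w :
    closed_route nd sg i r -> route_length sg i r = 2 * l + 1 ->
    {subset s <= trail nd sg i r} -> w \notin U ->
  at_most_one_neighbour w s.
Proof.
move=> rt len sub_s wU x y /sub_s xr /sub_s yr; have [cyc _] := closed_route_cycle rt.
apply: (odd_cycle_at_most_one_neighbour l_ge2 oneG cyc _ _ xr yr); first by rewrite size_trail.
apply: contra wU; apply: trail_in_skeleton.
by have /and4P[/and4P[]] := rt.
Qed.

Lemma ear_length i r h p :
    open_route nd sg i r -> 0 < size r ->
    induced_path (h :: p) -> {in h :: p, forall v, v \notin U} ->
    adj (nth x0 nd i) h -> adj (last h p) (nth x0 nd (last i r)) ->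
    {in h :: p & nth x0 nd i :: trail nd sg i r, forall v x, adj v x ->
      (v = h /\ x = nth x0 nd i) \/ (v = last h p /\ x = nth x0 nd (last i r))} ->
  hole_length l (size p + route_length sg i r + 2).
Proof.
move=> rt r_gt0 ip pU adj_ih adj_pr cross; have /andP[/and4P[lt_i path_r _ _] _] := rt.
have rev_p : rev (h :: p) = last h p :: rev (belast h p) by rewrite lastI rev_rcons.
have last_rev_p : last (last h p) (rev (belast h p)) = h.
  by case: (p) => //= v s; rewrite rev_cons last_rcons.
pose c := nth x0 nd i :: trail nd sg i r ++ last h p :: rev (belast h p).
have -> : size p + route_length sg i r + 2 = size c.
  by rewrite /c -rev_p /= size_cat size_rev size_trail /=; clear; lia.
suff [cyc chord] : is_cycle c /\ chordless c by apply: chordless_cycle_length.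
apply: induced_paths_chordless_cycle.
- exact: open_route_induced.
- by rewrite -rev_p; apply: induced_path_rev.
- by rewrite size_trail ltn_addr // (leq_trans r_gt0) ?size_le_route_length.
- move=> x xr; rewrite -rev_p mem_rev; apply/negP=> /pU/negP; apply.
  move: xr; rewrite inE => /orP[/eqP->|]; first exact: node_in_skeleton.
  exact: trail_in_skeleton.
- by rewrite last_trail adj_sym.
- by rewrite last_rev_p adj_sym.
move=> x v xr; rewrite -rev_p mem_rev last_rev_p last_trail adj_sym => vp vx.
by case: (cross v x vp xr vx) => [[-> ->]|[-> ->]]; [right|left].
Qed.

Lemma jump_length M i r h p :
    induced_path (h :: p) -> {in h :: p, forall v, v \notin U} -> adj (nth x0 nd i) h ->
    {in h :: p & U, forall v x, adj v x -> (v = h /\ x = nth x0 nd i) \/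
      (v = last h p /\ x \in [seq nth x0 nd m | m <- M])} ->
    jump (last h p) nd sg M i r ->
  hole_length l (size p + route_length sg i r + 2).
Proof.
move=> ip pU adj_ih att /and4P[rt r_gt0 adj_pr /allP avoid].
apply: (@ear_length i r h p) => // v x vp xr vx; have /andP[/and4P[lt_i path_r _ _] _] := rt.
have xU : x \in U.
  move: xr; rewrite inE => /orP[/eqP->|]; [exact: node_in_skeleton|exact: trail_in_skeleton].
case: (att v x vp xU vx) => [|[vE /mapP[m mM xE]]]; [by left|right; split=> //].
have /andP[lt_m /or3P[/eqP mE|m_r|/negP[]]] := avoid m mM.
- by rewrite xE mE.
- case/negP: m_r; move: xr; rewrite xE !inE => /orP[/eqP/(node_inj lt_m lt_i)->|].
    by rewrite eqxx.
  by move/(trail_node path_r lt_m)->; rewrite orbT.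
- by rewrite -xE -vE.
Qed.

Lemma vertex_jump_length M i r w :
    w \notin U -> {in U, forall x, adj w x -> x \in [seq nth x0 nd m | m <- M]} ->
    adj w (nth x0 nd i) && jump w nd sg [seq m <- M | m != i] i r ->
  hole_length l (route_length sg i r + 2).
Proof.
move=> wU att /andP[wi jmp]; apply: (@jump_length _ i r w [::]) jmp => //.
- exact: induced_path1.
- by move=> v; rewrite inE => /eqP->.
- by rewrite adj_sym.
move=> v x; rewrite inE => /eqP-> xU /(att x xU)/mapP[m mM xE].
have [mi|mi] := eqVneq m i; [by left; rewrite xE mi|right; split=> //].
by rewrite xE; apply/map_f; rewrite mem_filter mi.
Qed.

End Jumps.
End Routes.
End Skeleton.

(* With these, simplification computes the conditions on routes through an explicit
   skeleton, down to inequalities between the sizes of its segments. *)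
Arguments hole_length l n /.
Arguments subdivide {G} k m p q sg /.
Arguments seg_at {G} sg k /.
Arguments joins {G} i j t /.
Arguments linked {G} sg i j /.
Arguments seg_index {G} sg i j /.
Arguments traversed {G} sg i r /.
Arguments chordfree {G} sg i r /.
Arguments route {G} nd sg i r /.
Arguments open_route {G} nd sg i r /.
Arguments closed_route {G} nd sg i r /.
Arguments route_length {G} sg i r /.
Arguments jump {G} x0 w nd sg M i r /.

(** * Skeletons from arrises *)

Section Arrises.
Variable H : sgraph.
Implicit Types (u v x y : H) (s : seq H).

Definition arris u v s : Prop :=
  [/\ sorted (@adj H) (u :: rcons s v), uniq (u :: rcons s v) &
      {in s, forall x, degree x <= 2}].

Lemma arris_rev u v s : arris u v s -> arris v u (rev s).
Proof.
have revE : v :: rcons (rev s) u = rev (u :: rcons s v) by rewrite rev_cons rev_rcons.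
case=> path_s uniq_s deg_s; split; rewrite ?revE ?sorted_rev ?rev_uniq // => x.
by rewrite mem_rev; apply: deg_s.
Qed.

Lemma arris_first u v s : arris u v s -> adj u (head v s).
Proof. by case; case: s => [|x s] /= /andP[]. Qed.

Lemma arris_first_edge u v s : on_path_edge (u :: rcons s v) u (head v s).
Proof.
by apply/orP; left; apply/infixP; exists [::], (behead (rcons s v)); case: s.
Qed.

Lemma is_arrisP u v (p : seq H) :
    (forall x : H, degree x <= 3) -> u != v -> is_arris u v p ->
  exists2 s, p = u :: rcons s v & arris u v s.
Proof.
move=> deg_le3 uv [[q [pE path_q uniq_p last_q]] deg_u deg_v two_deg3].
case/lastP: q => [|s w] in pE path_q uniq_p last_q; first by rewrite -last_q eqxx in uv.
rewrite last_rcons in last_q; subst w; exists s => //; split=> //; first by rewrite -pE.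
move=> x x_s; have := deg_le3 x; rewrite leq_eqVlt ltnS => /orP[/eqP deg_x|//].
rewrite pE /= rcons_uniq mem_rcons inE negb_or in uniq_p.
have /and3P[/andP[_ u_s] v_s _] := uniq_p.
have : #|[set x; u; v]| <= 2.
  rewrite -two_deg3; apply/subset_leq_card/subsetP=> y; rewrite !inE pE inE mem_rcons inE.
  by case/orP=> [/orP[]|] /eqP->; rewrite ?deg_x ?deg_u ?deg_v ?x_s ?eqxx ?orbT.
have xu : x != u by apply: contraNneq u_s => <-.
have xv : x != v by apply: contraNneq v_s => <-.
by rewrite -setUA cardsU1 cards2 uv !inE negb_or xu xv.
Qed.

Lemma arris_interior_edge u v s x y :
  arris u v s -> x \in s -> adj x y -> on_path_edge (u :: rcons s v) x y.
Proof.
case=> path_s uniq_s deg_s xs; have [s1 [s2 sE]] := mem_split xs.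
have splitE : u :: rcons s v = rcons (u :: s1) x ++ rcons s2 v.
  by rewrite sE rcons_cat cat_rcons.
move: path_s uniq_s; rewrite splitE => path_s uniq_s.
have x_next : adj x (head v s2).
  move: path_s; rewrite /= cat_path last_rcons => /andP[_].
  by case: (s2) => [|b t] /= /andP[].
have x_prev : adj (last u s1) x.
  by move: path_s; rewrite /= cat_path rcons_path => /andP[/andP[]].
have prev_next : last u s1 != head v s2.
  move: uniq_s; rewrite cat_uniq => /and3P[_ /hasPn dis _].
  have /dis : head v s2 \in rcons s2 v.
    by case: (s2) => [|b t]; rewrite /= ?inE ?mem_rcons ?inE eqxx ?orbT.
  by apply: contraNneq => <-; rewrite mem_rcons inE mem_last orbT.
have nbrs : [set last u s1; head v s2] = [set z | adj x z].
  apply/eqP; rewrite eqEcard cards2 prev_next deg_s // andbT.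
  by apply/subsetP=> z; rewrite !inE => /orP[]/eqP->; rewrite // adj_sym.
move=> xy; have : y \in [set z | adj x z] by rewrite inE.
rewrite -nbrs !inE => /orP[]/eqP->; apply/orP; [right|left].
  rewrite cat_rcons (lastI u s1) cat_rcons; apply/infixP.
  by exists (belast u s1), (rcons s2 v).
rewrite cat_rcons; apply/infixP; exists (u :: s1), (behead (rcons s2 v)).
by case: (s2).
Qed.

Lemma arris_meet u v s u' v' s' x :
    arris u v s -> arris u' v' s' -> 2 < degree u -> 2 < degree v ->
    2 < degree u' -> 2 < degree v' -> x \in s -> x \in s' ->
  (u \in [:: u'; v']) && (v \in [:: u'; v']).
Proof.
move=> arr arr' du dv du' dv' xs xs'; have [path_s _ s_le2] := arr; have [_ _ s'_le2] := arr'.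
have nbr c d : c \in s' -> adj c d -> (d \in [:: u'; v']) || (d \in s').
  move=> cs' /(arris_interior_edge arr' cs')/on_path_edge_mem/andP[_].
  by rewrite !inE mem_rcons inE => /or3P[]->; rewrite ?orbT.
have interior_edge c d : c \in s -> adj c d -> c \in s' -> d \in s -> d \in s'.
  move=> cs cd cs' ds; have := nbr c d cs' cd; rewrite !inE => /orP[/orP[]/eqP dE|//].
    by have := s_le2 d ds; rewrite dE leqNgt du'.
  by have := s_le2 d ds; rewrite dE leqNgt dv'.
have s_s' : {in s, forall y, y \in s'}.
  move=> y ys; suff -> : (y \in s') = (x \in s') by [].
  apply: (sorted_const (e := @adj H) (P := mem s')) ys xs.
    by move: path_s => /= /path_sorted; rewrite -cats1 => /cat_sorted2[].
  move=> c d cs ds cd; apply/idP/idP=> [cs'|ds']; first exact: interior_edge cd cs' ds.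
  by apply: interior_edge ds' cs => //; rewrite adj_sym.
have first_s : head x s \in s by case: (s) xs => // b t _; rewrite mem_head.
have last_s : last x s \in s by case: (s) xs => // b t _; apply: (mem_last b t).
have first_u : adj (head x s) u.
  by move: path_s xs; case: (s) => //= b t /andP[ub _] _; rewrite adj_sym.
have last_v : adj (last x s) v.
  by move: path_s xs; case: (s) => //= b t; rewrite rcons_path => /and3P[_ _ ->].
have end_off w : 2 < degree w -> w \notin s' by apply: contraL => /s'_le2; rewrite -leqNgt.
have := nbr _ _ (s_s' _ first_s) first_u; rewrite (negbTE (end_off u du)) orbF => ->.
by have := nbr _ _ (s_s' _ last_s) last_v; rewrite (negbTE (end_off v dv)) orbF.
Qed.

Section ArrisSkeleton.
Variables (x0 : H) (nd : seq H) (sg : seq (segment H)).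
Implicit Types (t : segment H) (i j : nat).

Hypothesis nd_uniq : uniq nd.
Hypothesis sg_uniq : uniq sg.
Hypothesis sg_simple : {in sg &, forall t t', joins t.1.1 t.1.2 t' -> t = t'}.
Hypothesis ends_lt : {in sg, forall t, (t.1.1 < size nd) && (t.1.2 < size nd)}.
Hypothesis sg_arris : {in sg, forall t, arris (nth x0 nd t.1.1) (nth x0 nd t.1.2) t.2}.
Hypothesis nd_degree_gt2 : {in nd, forall u, 2 < degree u}.
Hypothesis nd_degree : forall i, i < size nd -> degree (nth x0 nd i) = count (incident i) sg.

Lemma node_degree_gt2 i : i < size nd -> 2 < degree (nth x0 nd i).
Proof. by move/(mem_nth x0)/nd_degree_gt2. Qed.

Lemma node_not_interior i t : i < size nd -> t \in sg -> nth x0 nd i \notin t.2.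
Proof.
move=> lt_i t_sg; have [_ _ interior_le2] := sg_arris t_sg.
by apply/negP=> /interior_le2; rewrite leqNgt node_degree_gt2.
Qed.

Lemma arris_interiors_disjoint t t' x :
  t \in sg -> t' \in sg -> x \in t.2 -> x \in t'.2 -> t = t'.
Proof.
move=> t_sg t'_sg xt xt'; apply: sg_simple => //.
have /andP[lt_a lt_b] := ends_lt t_sg; have /andP[lt_a' lt_b'] := ends_lt t'_sg.
have ab : nth x0 nd t.1.1 != nth x0 nd t.1.2.
  by have [_] := sg_arris t_sg; rewrite /= mem_rcons inE negb_or => /andP[/andP[]].
have := arris_meet (sg_arris t_sg) (sg_arris t'_sg) (node_degree_gt2 lt_a)
  (node_degree_gt2 lt_b) (node_degree_gt2 lt_a') (node_degree_gt2 lt_b') xt xt'.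
rewrite nth_uniq // in ab; rewrite !inE !nth_uniq //; move: ab; rewrite /joins.
case: t.1 t'.1 {t_sg t'_sg xt xt' lt_a lt_b lt_a' lt_b'} => [a b] [a' b'] /=.
rewrite !xpair_eqE => ab /andP[/orP[]/eqP aE /orP[]/eqP bE].
- by rewrite aE bE eqxx in ab.
- by rewrite aE bE !eqxx.
- by rewrite aE bE !eqxx orbT.
- by rewrite aE bE eqxx in ab.
Qed.

Definition orient i t : segment H := if t.1.1 == i then t else (t.1.2, t.1.1, rev t.2).

Lemma orientP i t : incident i t ->
  [/\ (orient i t).1.1 = i, joins i (orient i t).1.2 t, (orient i t).2 =i t.2 &
      on_path_edge (seg_vertices x0 nd (orient i t)) =2 on_path_edge (seg_vertices x0 nd t)].
Proof.
rewrite /incident /orient /joins; case: t => [[a b] s] /=.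
case: eqP => [->|_] /=; first by rewrite eqxx.
move/eqP=> <-; split=> //= [|x|x y]; rewrite ?eqxx ?orbT ?mem_rev //.
by rewrite -on_path_edge_rev /seg_vertices /= rev_cons rev_rcons revK.
Qed.

Lemma orient_lt i t : t \in sg -> (orient i t).1.2 < size nd.
Proof. by rewrite /orient => /ends_lt/andP[la lb]; case: ifP. Qed.

Lemma orient_arris i t : t \in sg -> incident i t ->
  arris (nth x0 nd i) (nth x0 nd (orient i t).1.2) (orient i t).2.
Proof.
rewrite /incident /orient => /sg_arris; case: eqP => [->//|_] arr /= /eqP <-.
exact: arris_rev.
Qed.

Definition first_from i t : H := head (nth x0 nd (orient i t).1.2) (orient i t).2.

Lemma first_from_inj i : {in [seq t <- sg | incident i t] &, injective (first_from i)}.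
Proof.
move=> t t'; rewrite !mem_filter => /andP[inc t_sg] /andP[inc' t'_sg].
have [_ join_t interior_t _] := orientP inc; have [_ join_t' interior_t' _] := orientP inc'.
have lt_j := orient_lt i t_sg; have lt_j' := orient_lt i t'_sg.
move: interior_t interior_t'; rewrite /first_from.
case: (orient i t).2 => [|x s] interior_t; case: (orient i t').2 => [|x' s'] interior_t' /=.
- move/eqP; rewrite nth_uniq // => /eqP j_eq; apply: sg_simple => //.
  move: join_t join_t'; rewrite -j_eq /joins; case: t.1 t'.1 => [a b] [a' b'] /=.
  by rewrite !xpair_eqE => /orP[]/andP[/eqP-> /eqP->]; rewrite // orbC.
- move=> j_x'; have := node_not_interior lt_j t'_sg.
  by rewrite j_x' -interior_t' mem_head.
- move=> x_j'; have := node_not_interior lt_j' t_sg.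
  by rewrite -x_j' -interior_t mem_head.
- move=> xx'; apply: (@arris_interiors_disjoint _ _ x) => //.
    by rewrite -interior_t mem_head.
  by rewrite xx' -interior_t' mem_head.
Qed.

(* The first vertices of the segments at a node are distinct neighbours of it; by the
   degree condition they are all of them. *)
Lemma node_edge i y : i < size nd -> adj (nth x0 nd i) y ->
  exists2 t, t \in sg & on_path_edge (seg_vertices x0 nd t) (nth x0 nd i) y.
Proof.
move=> lt_i iy; pose first_verts := [seq first_from i t | t <- sg & incident i t].
have first_nbr : {subset first_verts <= enum [set z | adj (nth x0 nd i) z]}.
  move=> _ /mapP[t + ->]; rewrite mem_filter => /andP[inc t_sg].
  by rewrite mem_enum inE; apply/arris_first/orient_arris.
have first_uniq : uniq first_verts.
  by rewrite map_inj_in_uniq ?filter_uniq //; apply: first_from_inj.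
have first_all : size (enum [set z | adj (nth x0 nd i) z]) <= size first_verts.
  by rewrite -cardE -/(degree _) nd_degree // size_map size_filter.
have : y \in first_verts.
  by rewrite (uniq_min_size first_uniq first_nbr first_all).2 mem_enum inE.
case/mapP=> t; rewrite mem_filter => /andP[inc t_sg] ->; exists t => //.
have [start_i _ _ <-] := orientP inc.
by rewrite /seg_vertices start_i; apply: arris_first_edge.
Qed.

Lemma arris_skeleton : skeleton x0 [in skel_vertices nd sg] nd sg.
Proof.
have interiors_uniq : uniq (flatten [seq t.2 | t <- sg]).
  suff sub_uniq r : uniq r -> {subset r <= sg} -> uniq (flatten [seq t.2 | t <- r]).
    by apply: sub_uniq.
  elim: r => //= t r IHr /andP[t_r ur] sub.
  have t_sg : t \in sg by apply: sub; rewrite mem_head.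
  rewrite cat_uniq IHr //; last by move=> t' t'r; apply: sub; rewrite inE t'r orbT.
  have [_ /= + _] := sg_arris t_sg; rewrite rcons_uniq => /and3P[_ _ ->] /=; rewrite andbT.
  apply/hasPn=> x /flattenP[s /mapP[t' t'r ->] xt']; apply: contra t_r => xt.
  by rewrite (arris_interiors_disjoint t_sg _ xt xt') //; apply: sub; rewrite inE t'r orbT.
split=> //.
- split=> //; rewrite cat_uniq nd_uniq interiors_uniq andbT; apply/hasPn=> x.
  case/flattenP=> s /mapP[t t_sg ->] xt; apply/negP=> x_nd.
  have := @node_not_interior (index x nd) t; rewrite index_mem nth_index // xt.
  by move=> /(_ x_nd t_sg).
- by move=> t /sg_arris[].
move=> x y; rewrite mem_cat => /orP[x_nd _ xy|/flattenP[s /mapP[t t_sg ->] xt] _ xy].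
  by have := @node_edge (index x nd) y; rewrite index_mem nth_index // => /(_ x_nd xy).
by exists t => //; apply: arris_interior_edge (sg_arris t_sg) xt xy.
Qed.

End ArrisSkeleton.
End Arrises.

Lemma skeleton_to_ambient (G : sgraph) (S : {set G}) (x0 : induced S)
    (nd : seq (induced S)) (sg : seq (segment (induced S))) :
    let sgG := [seq (t.1, to_ambient t.2) | t <- sg] in
    skeleton x0 [in skel_vertices nd sg] nd sg ->
  skeleton (val x0) [in skel_vertices (to_ambient nd) sgG] (to_ambient nd) sgG.
Proof.
pose f (t : segment (induced S)) : segment G := (t.1, to_ambient t.2).
move=> /= [[uV _] ends paths edges].
have VE : skel_vertices (to_ambient nd) [seq f t | t <- sg] = to_ambient (skel_vertices nd sg).
  by rewrite /skel_vertices /to_ambient map_cat map_flatten -!map_comp.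
have verticesE t : t \in sg ->
    seg_vertices (val x0) (to_ambient nd) (f t) = to_ambient (seg_vertices x0 nd t).
  case/ends/andP=> lt_a lt_b.
  by rewrite /seg_vertices /to_ambient /= map_rcons !(nth_map x0).
split.
- by split=> //; rewrite VE map_inj_uniq //; apply: val_inj.
- by move=> _ /mapP[t t_sg ->]; rewrite /= size_map; apply: ends.
- move=> _ /mapP[t t_sg ->]; rewrite verticesE // /to_ambient sorted_map; exact: paths.
rewrite VE => _ _ /mapP[x xV ->] /mapP[y yV ->] xy; have [t t_sg e] := edges x y xV yV xy.
exists (f t); [exact: map_f|rewrite verticesE //].
by case/orP: e => /infixP[s1 [s2 ->]]; apply/orP; [left|right]; apply/infixP;
  exists (to_ambient s1), (to_ambient s2); rewrite /to_ambient !map_cat.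
Qed.

Section SubdivisionDegree.
Variables (F H : sgraph) (b : F -> H) (p : F -> F -> seq H).
Hypothesis path_p : forall x y, adj x y -> is_path (b x) (b y) (p x y) /\ p y x = rev (p x y).
Hypothesis branch_p : forall x y z, adj x y -> b z \in p x y -> z = x \/ z = y.
Hypothesis edge_p : forall h k : H, adj h k -> exists x y, adj x y /\ on_path_edge (p x y) h k.

Lemma branch_degree z : injective b -> degree (b z) <= degree z.
Proof.
pose f y := nth (b z) (p z y) 1.
suff /subset_leq_card : [set k | adj (b z) k] \subset [set f y | y in [set y | adj z y]].
  by move=> le binj; apply: leq_trans le (leq_imset_card _ _).
have first y k : adj z y -> on_path_edge (p z y) (b z) k -> k = f y.
  move=> zy; have [[q [pE _ uq _]] _] := path_p zy; rewrite /f pE in uq *.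
  case/orP=> [e|/infixP[[|a s1]] [s2 /= [aE qE]]].
  - by rewrite (@infix2_next _ [::] q (b z) k (b z)) // -nth0.
  - by move: uq; rewrite qE /= inE aE eqxx.
  - by move: uq; rewrite qE /= mem_cat !inE eqxx !orbT.
apply/subsetP=> k; rewrite inE => /edge_p[x [y [xy e]]].
have /andP[z_p _] := on_path_edge_mem e.
case: (branch_p xy z_p) => zE; rewrite -zE in xy e.
  by apply/imsetP; exists y; [rewrite inE|exact: first].
have zx : adj z x by rewrite adj_sym.
apply/imsetP; exists x; [by rewrite inE|apply: first => //].
by case: (path_p xy) => _ ->; rewrite on_path_edge_rev.
Qed.

Lemma interior_degree x y h :
    (forall x' y', adj x' y' -> h \in p x' y' -> [set x'; y'] = [set x; y]) ->
    adj x y -> h \in p x y ->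
  degree h <= 2.
Proof.
move=> only_xy xy hp; have [s1 [s2 pE]] := mem_split hp.
suff /subset_leq_card : [set k | adj h k] \subset [set head h s2; last h s1].
  by move=> le; apply: leq_trans le _; rewrite cards2; case: (_ != _).
have [[q [_ _ up _]] p_rev] := path_p xy; have xny : x != y.
  by apply: contraTneq xy => ->; rewrite adj_irrefl.
apply/subsetP=> k; rewrite inE => /edge_p[x' [y' [x'y' e]]].
have /andP[hp' _] := on_path_edge_mem e.
have {e} : on_path_edge (p x y) h k.
  have xyE := only_xy _ _ x'y' hp'.
  have : x' \in [set x; y] by rewrite -xyE !inE eqxx.
  have : y' \in [set x; y] by rewrite -xyE !inE eqxx orbT.
  have x'ny' : x' != y' by apply: contraTneq x'y' => ->; rewrite adj_irrefl.
  rewrite !inE => /orP[]/eqP yE /orP[]/eqP xE; rewrite xE yE ?eqxx // in e x'ny'.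
  by rewrite p_rev on_path_edge_rev in e.
rewrite pE in up *.
rewrite !inE => /orP[] e; first by rewrite (infix2_next h up e) eqxx.
have revE : rev (s1 ++ h :: s2) = rev s2 ++ h :: rev s1.
  by rewrite rev_cat rev_cons cat_rcons.
have {}e : infix [:: h; k] (rev (s1 ++ h :: s2)) by rewrite -infix_revLR.
rewrite revE in e; rewrite -rev_uniq revE in up.
rewrite (infix2_next h up e).
by case/lastP: (s1) => [|t a]; rewrite ?rev_rcons ?last_rcons /= eqxx orbT.
Qed.

End SubdivisionDegree.

Lemma subdivision_degree (F H : sgraph) (d : nat) (h : H) :
    2 <= d -> (forall z : F, degree z <= d) -> is_subdivision F H -> degree h <= d.
Proof.
move=> d_ge2 degF [b [p [binj path_p branch_p meet_p [cover edge_p]]]].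
have [/existsP[z /eqP->]|/existsPn not_branch] := boolP [exists z, h == b z].
  exact: leq_trans (branch_degree path_p branch_p edge_p z binj) (degF z).
apply: leq_trans _ d_ge2; have [[z hz]|[x [y [xy hp]]]] := cover h.
  by have := not_branch z; rewrite hz eqxx.
apply: (interior_degree path_p edge_p _ xy hp) => x' y' x'y' hp'.
apply/eqP/negPn/negP => other; have [z hz] := meet_p x' y' x y x'y' xy other h hp' hp.
by have := not_branch z; rewrite hz eqxx.
Qed.


(** * Balanced subdivisions of K4 *)

Lemma degree_complete n (i : complete n) : degree i = n.-1.
Proof.
rewrite /degree; have -> : [set j | adj i j] = [set~ i :> 'I_n].
  by apply/setP=> j; rewrite !inE eq_sym.
by rewrite cardsC1 card_ord.
Qed.

Definition k4_segments (H : sgraph) (P1 Q1 Q2 P2 L1 L2 : seq H) : seq (segment H) :=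
  [:: (0, 1, P1); (1, 2, Q1); (0, 3, Q2); (2, 3, P2); (0, 2, L1); (1, 3, L2)].

Lemma k4_skeleton (H : sgraph) (u1 u2 u3 u4 : H) (P1 Q1 Q2 P2 L1 L2 : seq H) :
    let nd := [:: u1; u2; u3; u4] in let sg := k4_segments P1 Q1 Q2 P2 L1 L2 in
    uniq nd -> {in nd, forall u, degree u = 3} ->
    {in sg, forall t, arris (nth u1 nd t.1.1) (nth u1 nd t.1.2) t.2} ->
  skeleton u1 [in skel_vertices nd sg] nd sg.
Proof.
move=> nd sg nd_uniq deg3 arr; apply: arris_skeleton => //.
- by move=> t t'; rewrite !inE => /or4P[| | |/or3P[]]/eqP-> /or4P[| | |/or3P[]]/eqP->.
- by move=> t; rewrite !inE => /or4P[| | |/or3P[]]/eqP->.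
- by move=> u /deg3->.
by move=> i lt_i; rewrite deg3 ?mem_nth //; case: i lt_i => [|[|[|[|]]]].
Qed.

Lemma balanced_K4_skeleton (G : sgraph) :
  contains_balanced_K4_subdivision_12 G ->
  exists (u1 u2 u3 u4 : G) (P1 Q2 P2 L1 L2 : seq G),
  let sg := k4_segments P1 [::] Q2 P2 L1 L2 in
  [/\ skeleton u1 [in skel_vertices [:: u1; u2; u3; u4] sg] [:: u1; u2; u3; u4] sg,
      odd (size P1 + size L1 + 3), odd (size P1 + size L2 + size Q2 + 3),
      ~~ odd (size P2 + size L2 + 3) & 0 < size L2].
Proof.
case=> S [sub [u1 [u2 [u3 [u4 [P1 [P2 [Q1 [Q2 [L1 [L2]]]]]]]]]]].
have deg_le3 (h : induced S) : degree h <= 3.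
  by apply: subdivision_degree sub => // z; rewrite degree_complete.
case=> -[nd_uniq degE] [aP1 aP2 aQ1 aQ2 [aL1 aL2]] [[_ odd1] [_ odd2]] [[_ even3] _].
case=> Q1_len L2_len.
have deg3 : {in [:: u1; u2; u3; u4], forall u, degree u = 3}.
  move=> u u_nd; have : u \in [set u1; u2; u3; u4] by rewrite !inE -!orbA in u_nd *.
  by rewrite -degE inE => /eqP.
have neq i j : i < 4 -> j < 4 -> i != j ->
    nth u1 [:: u1; u2; u3; u4] i != nth u1 [:: u1; u2; u3; u4] j.
  by move=> lt_i lt_j; rewrite nth_uniq.
have [p1 P1E arrP1] := is_arrisP deg_le3 (neq 0 1 isT isT isT) aP1.
have [p2 P2E arrP2] := is_arrisP deg_le3 (neq 2 3 isT isT isT) aP2.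
have [q1 Q1E arrQ1] := is_arrisP deg_le3 (neq 1 2 isT isT isT) aQ1.
have [q2 Q2E arrQ2] := is_arrisP deg_le3 (neq 0 3 isT isT isT) aQ2.
have [l1 L1E arrL1] := is_arrisP deg_le3 (neq 0 2 isT isT isT) aL1.
have [l2 L2E arrL2] := is_arrisP deg_le3 (neq 1 3 isT isT isT) aL2.
have q1_nil : q1 = [::].
  by move: Q1_len; rewrite /plength Q1E /= size_rcons; case: (q1).
have sk : skeleton u1 [in skel_vertices [:: u1; u2; u3; u4] (k4_segments p1 [::] q2 p2 l1 l2)]
    [:: u1; u2; u3; u4] (k4_segments p1 [::] q2 p2 l1 l2).
  by apply: k4_skeleton => // t; rewrite !inE => /or4P[| | |/or3P[]]/eqP->; rewrite /= -?q1_nil.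
exists (val u1), (val u2), (val u3), (val u4); exists (to_ambient p1), (to_ambient q2).
exists (to_ambient p2), (to_ambient l1), (to_ambient l2).
split; first exact: skeleton_to_ambient sk.
- move: odd1; rewrite /to_ambient /close3 !size_map !size_cat !size_behead size_rev.
  by rewrite P1E Q1E L1E q1_nil /= !size_rcons /=; clear; lia.
- move: odd2; rewrite /to_ambient /close3 !size_map !size_cat !size_behead size_rev.
  by rewrite P1E Q2E L2E /= !size_rcons /=; clear; lia.
- move: even3; rewrite /to_ambient /close3 !size_map !size_cat !size_behead size_rev.
  by rewrite P2E Q1E L2E q1_nil /= !size_rcons /=; clear; lia.
by move: L2_len; rewrite /plength L2E /to_ambient size_map /= size_rcons.
Qed.

Lemma balanced_lengths l (G : sgraph) U (u1 u2 u3 u4 : G) (P1 Q2 P2 L1 L2 : seq G) :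
    2 <= l -> one_odd_hole_length l G ->
    skeleton u1 U [:: u1; u2; u3; u4] (k4_segments P1 [::] Q2 P2 L1 L2) ->
    odd (size P1 + size L1 + 3) -> odd (size P1 + size L2 + size Q2 + 3) ->
    ~~ odd (size P2 + size L2 + 3) -> 0 < size L2 ->
  [&& size P1 + size L1 + 2 == 2 * l, size P1 + size L2 + size Q2 + 2 == 2 * l,
      size P1 + size P2 + size Q2 + 3 == 2 * l & l <= size P2 + 1].
Proof.
move=> l_ge2 oneG sk odd1 odd2 even3 L2_gt0.
have hole i r := closed_route_length sk l_ge2 oneG (i := i) (r := r).
move: (hole 0 [:: 1; 2; 0]) (hole 0 [:: 1; 3; 0]) (hole 1 [:: 2; 3; 1])
  (hole 0 [:: 1; 2; 3; 0]) => /=.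
move: odd1 odd2 even3 L2_gt0; clear; lia.
Qed.

(** * Jumps from the middle of P2 *)

(* Node numbers: [z3], [z], [z4] are consecutive vertices in the middle of P2, [y1] and
   [y2] lie inside L1 and L2, and [y] inside a further segment. *)
Local Notation i1 := 0 (only parsing).
Local Notation i2 := 1 (only parsing).
Local Notation i3 := 2 (only parsing).
Local Notation i4 := 3 (only parsing).
Local Notation iz3 := 4 (only parsing).
Local Notation iz := 5 (only parsing).
Local Notation iz4 := 6 (only parsing).
Local Notation iy1 := 7 (only parsing).
Local Notation iy2 := 8 (only parsing).
Local Notation iy := 9 (only parsing).

(* If [w] has no neighbour on [s], any vertex of [s] serves as [y]; this saves a case
   distinction each time. *)
Lemma at_most_one_neighbour_split (G : sgraph) (s : seq G) w :
    0 < size s -> at_most_one_neighbour w s ->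
  exists s1 y s2, s = s1 ++ y :: s2 /\ {in s, forall x, adj w x -> x = y}.
Proof.
move=> s_gt0 uniq_nbr; have [/hasP[y ys wy]|/hasPn no_nbr] := boolP (has (adj w) s).
  have [s1 [s2 sE]] := mem_split ys; exists s1, y, s2; split=> // x xs wx.
  exact: uniq_nbr.
case: s s_gt0 no_nbr {uniq_nbr} => // y s _ no_nbr; exists [::], y, s; split=> // x xs wx.
by have := no_nbr x xs; rewrite wx.
Qed.

Section Window.
Variables (l : nat) (G : sgraph) (U : {pred G}).
Variables (u1 u2 u3 u4 z3 z z4 : G) (P1 Q2 S3 S4 L1 L2 : seq G).

(* P2 is split as [S3 ++ [:: z3, z, z4 & S4]]. *)
Definition window_nodes : seq G := [:: u1; u2; u3; u4; z3; z; z4].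
Definition window_segments : seq (segment G) :=
  [:: (i1, i2, P1); (i2, i3, [::]); (i1, i4, Q2); (i3, iz3, S3); (iz3, iz, [::]);
      (iz, iz4, [::]); (iz4, i4, S4); (i1, i3, L1); (i2, i4, L2)].

Hypothesis oneG : one_odd_hole_length l G.
Hypothesis sk : skeleton u1 U window_nodes window_segments.
Hypothesis sizes : [&& 5 <= l, size P1 + size L1 + 2 == 2 * l,
  size P1 + size L2 + size Q2 + 2 == 2 * l,
  size P1 + (size S3 + size S4 + 3) + size Q2 + 3 == 2 * l,
  l <= size S3 + size S4 + 4 & size S4 <= size S3 <= size S4 + 1].

Let l_ge2 : 2 <= l.
Proof. by move: sizes; clear; lia. Qed.

(* These list the vertices of the odd holes P1 Q1 L1, P1 Q2 L2 and P1 Q1 P2 Q2, though not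
   in cyclic order. *)
Definition odd_hole_L1 : seq G := [:: u1; u2; u3] ++ P1 ++ L1.
Definition odd_hole_L2 : seq G := [:: u1; u2; u4] ++ P1 ++ L2 ++ Q2.
Definition odd_hole_P2 : seq G := window_nodes ++ P1 ++ Q2 ++ S3 ++ S4.

Lemma odd_hole_L1_one_neighbour w : w \notin U -> at_most_one_neighbour w odd_hole_L1.
Proof.
apply: (route_at_most_one_neighbour sk l_ge2 oneG (i := i1) (r := [:: i2; i3; i1])) => //=.
  by move: sizes; clear; lia.
move=> x; rewrite /odd_hole_L1 /trail /= !(mem_cat, mem_rcons, mem_rev, inE) -!orbA.
by do ?[case/orP=> [->|]; rewrite ?orbT //] => ->; rewrite ?orbT.
Qed.

Lemma odd_hole_L2_one_neighbour w : w \notin U -> at_most_one_neighbour w odd_hole_L2.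
Proof.
apply: (route_at_most_one_neighbour sk l_ge2 oneG (i := i1) (r := [:: i2; i4; i1])) => //=.
  by move: sizes; clear; lia.
move=> x; rewrite /odd_hole_L2 /trail /= !(mem_cat, mem_rcons, mem_rev, inE) -!orbA.
by do ?[case/orP=> [->|]; rewrite ?orbT //] => ->; rewrite ?orbT.
Qed.

Lemma odd_hole_P2_one_neighbour w : w \notin U -> at_most_one_neighbour w odd_hole_P2.
Proof.
apply: (route_at_most_one_neighbour sk l_ge2 oneG (i := i1)
  (r := [:: i2; i3; iz3; iz; iz4; i4; i1])) => /=.
- by move: sizes; clear; lia.
- by move: sizes; clear; lia.
move=> x; rewrite /odd_hole_P2 /trail /= !(mem_cat, mem_rcons, mem_rev, inE) -!orbA.
by do ?[case/orP=> [->|]; rewrite ?orbT //] => ->; rewrite ?orbT.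
Qed.

Lemma window_vertex x : x \in U -> [|| x \in L1, x \in L2 | x \in odd_hole_P2].
Proof.
case: (sk) => -[_ <-] _ _ _.
rewrite /odd_hole_P2 /skel_vertices /= !(mem_cat, inE, orbF).
by do ?[case/orP=> [->|]; rewrite ?orbT //] => ->; rewrite ?orbT.
Qed.

Lemma L1_L2_off_odd_hole_P2 x : x \in L1 ++ L2 -> x \notin odd_hole_P2.
Proof.
case: (sk) => -[+ _] _ _ _.
have -> : skel_vertices window_nodes window_segments = odd_hole_P2 ++ (L1 ++ L2).
  by rewrite /skel_vertices /odd_hole_P2 /= cats0 -!catA.
by rewrite cat_uniq => /and3P[_ /hasPn dis _] /dis.
Qed.

Section Jump.
Variables (h : G) (p : seq G).
Let w := last h p.
Hypothesis induced_hp : induced_path (h :: p).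
Hypothesis hp_off : {in h :: p, forall v, v \notin U}.
Hypothesis zh : adj z h.
Hypothesis hp_attached : {in h :: p & U, forall v x, adj v x ->
  (v = h /\ x = z) \/ (v = w /\ x != z)}.

Let w_off : w \notin U.
Proof. exact/hp_off/mem_last. Qed.

Definition attached_to (s : seq G) : Prop :=
  {in U, forall x, adj w x -> x != z -> x \in s}.

Lemma jump_from_z nd sg M r : skeleton u1 U nd sg -> nth u1 nd iz = z ->
    attached_to [seq nth u1 nd m | m <- M] -> jump u1 w nd sg M iz r ->
  hole_length l (size p + route_length sg iz r + 2).
Proof.
move=> sk' ndz att; apply: (jump_length sk' l_ge2 oneG) => //; first by rewrite ndz.
move=> v x vp xU vx; rewrite ndz; case: (hp_attached vp xU vx) => [|[vw xz]]; [by left|].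
by right; split=> //; apply: att => //; rewrite -vw.
Qed.

Lemma jump_over_w nd sg M i r : skeleton u1 U nd sg -> nth u1 nd iz = z ->
    attached_to [seq nth u1 nd m | m <- M] ->
    adj w (nth u1 nd i) && jump u1 w nd sg [seq m <- iz :: M | m != i] i r ->
  hole_length l (route_length sg i r + 2).
Proof.
move=> sk' ndz att; apply: (vertex_jump_length sk' l_ge2 oneG) => // x xU wx.
have [xz|xz] := eqVneq x z; first by rewrite xz /= ndz mem_head.
by rewrite inE; apply/orP; right; apply: att.
Qed.

Section Refined.
Variables (L1a L1b L2a L2b : seq G) (y1 y2 : G).
Hypotheses (L1E : L1 = L1a ++ y1 :: L1b) (L2E : L2 = L2a ++ y2 :: L2b).

Definition refined_nodes : seq G := rcons (rcons window_nodes y1) y2.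
Definition refined_segments : seq (segment G) :=
  subdivide 9 iy2 L2a L2b (subdivide 7 iy1 L1a L1b window_segments).

Lemma refined_skeleton : skeleton u1 U refined_nodes refined_segments.
Proof. by do 2! [apply: skeleton_subdivide => //]. Qed.

Let refined_sizes :
  (size L1 == size L1a + (size L1b).+1) && (size L2 == size L2a + (size L2b).+1).
Proof. by rewrite L1E L2E !size_cat !eqxx. Qed.

Lemma jump_to_odd_hole_L1 x : x \in [:: u1; u2; u3] ++ P1 -> adj w x -> ~~ adj w y1.
Proof.
move=> x_L1 wx; apply/negP=> w1.
have y1_L1 : y1 \in L1 by rewrite L1E mem_cat mem_head orbT.
have xy1 : x = y1.
  apply: (odd_hole_L1_one_neighbour w_off) wx w1.
    by rewrite /odd_hole_L1 catA mem_cat x_L1.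
  by rewrite !mem_cat y1_L1 !orbT.
have := @L1_L2_off_odd_hole_P2 y1; rewrite mem_cat y1_L1 -xy1 => /(_ isT)/negP; apply.
by move: x_L1; rewrite !(mem_cat, inE) -!orbA => /or4P[]->; rewrite ?orbT.
Qed.

Lemma jump_to_odd_hole_L2 x : x \in [:: u1; u2; u4] ++ P1 ++ Q2 -> adj w x -> ~~ adj w y2.
Proof.
move=> x_L2 wx; apply/negP=> w2.
have y2_L2 : y2 \in L2 by rewrite L2E mem_cat mem_head orbT.
have xy2 : x = y2.
  apply: (odd_hole_L2_one_neighbour w_off) wx w2.
    by move: x_L2; rewrite !(mem_cat, inE) => /or3P[]->; rewrite ?orbT.
  by rewrite !mem_cat y2_L2 !orbT.
have := @L1_L2_off_odd_hole_P2 y2; rewrite mem_cat y2_L2 orbT -xy2 => /(_ isT)/negP; apply.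
by move: x_L2; rewrite !(mem_cat, inE) -!orbA => /or4P[|||/orP[]]->; rewrite ?orbT.
Qed.

(* In each case below, the cycles which the listed routes close up with the path [h :: p]
   ([hole_z]) or with [w] alone ([hole_w]) are holes, and they cannot all have length at
   least [2 * l + 1], with equality for the odd ones. Two routes from [z] to the same vertex
   of L1 or L2 often have lengths of different parity, so that one of the two holes has
   length [2 * l + 1]. *)
Lemma jump_to_y1_lengths : attached_to [:: y1; y2] -> adj w y1 ->
  [&& 2 * l + 1 <= size p + size S3 + size L1b + 5,
      2 * l + 1 <= size p + size S4 + size Q2 + size L1a + 6,
      [|| size L1b == 0, size p + size S3 + size L1b + 5 == 2 * l + 1 |
          size p + size S3 + size P1 + size L1a + 7 == 2 * l + 1] &
      [|| size L1a == 0, size p + size S4 + size Q2 + size L1a + 6 == 2 * l + 1 |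
          size p + size S4 + size Q2 + size P1 + size L1b + 8 == 2 * l + 1]].
Proof.
move=> att w1.
have hole_z := jump_from_z (M := [:: iy1; iy2]) (r := _) refined_skeleton erefl att.
apply/and4P; split.
- move: (hole_z [:: iz3; i3; iy1]) => /=.
  by rewrite w1 /=; move: sizes refined_sizes; clear; lia.
- move: (hole_z [:: iz4; i4; i1; iy1]) => /=.
  by rewrite w1 /=; move: sizes refined_sizes; clear; lia.
- move: (hole_z [:: iz3; i3; iy1]) (hole_z [:: iz3; i3; i2; i1; iy1]) => /=.
  by rewrite w1 /=; move: sizes refined_sizes; clear; lia.
move: (hole_z [:: iz4; i4; i1; iy1]) (hole_z [:: iz4; i4; i1; i2; i3; iy1]) => /=.
by rewrite w1 /=; move: sizes refined_sizes; clear; lia.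
Qed.

Lemma jump_to_y2_lengths : attached_to [:: y1; y2] -> adj w y2 ->
  (size L2b == size S3 + 2) && (size p + size S3 + size S4 + 6 == 2 * l).
Proof.
move=> att w2.
have hole_z := jump_from_z (M := [:: iy1; iy2]) (r := _) refined_skeleton erefl att.
move: (hole_z [:: iz4; i4; iy2]) (hole_z [:: iz3; i3; i2; iy2])
  (hole_z [:: iz4; i4; i1; i2; iy2]) (hole_z [:: iz3; i3; i2; i1; i4; iy2]) => /=.
by rewrite w2 /=; move: sizes refined_sizes; clear; lia.
Qed.

Lemma no_jump_to_L1_L2 : attached_to [:: y1; y2] -> ~~ (adj w y1 || adj w y2).
Proof.
move=> att.
have hole_z := jump_from_z (M := [:: iy1; iy2]) (r := _) refined_skeleton erefl att.
have hole_w := jump_over_w (M := [:: iy1; iy2]) (i := iy1) (r := _) refined_skeleton erefl att.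
have y1_lengths := jump_to_y1_lengths att; have y2_lengths := jump_to_y2_lengths att.
have [w2|w2] := boolP (adj w y2).
  move: (y2_lengths w2); have [w1|w1] := boolP (adj w y1) => /=.
    move: (y1_lengths w1) (hole_w [:: i1; i2; iy2]) (hole_w [:: i3; i2; i1; i4; iy2]) => /=.
    by rewrite w1 w2 /=; move: sizes refined_sizes; clear; lia.
  move: (hole_z [:: iz3; i3; iy1; i1; i4; iy2]) => /=.
  by rewrite (negbTE w1) w2 /=; move: sizes refined_sizes; clear; lia.
rewrite orbF; apply/negP=> w1.
move: (y1_lengths w1) (hole_z [:: iz4; i4; iy2; i2; i3; iy1])
  (hole_z [:: iz4; i4; iy2; i2; i1; iy1]) => /=.
by rewrite w1 (negbTE w2) /=; move: sizes refined_sizes; clear; lia.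
Qed.

Lemma no_jump_to_u1 : attached_to [:: u1; y1; y2] -> ~~ adj w u1.
Proof.
move=> att; apply/negP=> wu.
have w1 := jump_to_odd_hole_L1 (mem_head _ _) wu.
have w2 := jump_to_odd_hole_L2 (mem_head _ _) wu.
have hole_z := jump_from_z (M := [:: i1; iy1; iy2]) (r := _) refined_skeleton erefl att.
move: (hole_z [:: iz4; i4; i1]) (hole_z [:: iz3; i3; i2; i1])
  (hole_z [:: iz4; i4; iy2; i2; i1]) (hole_z [:: iz3; i3; iy1; i1]) => /=.
by rewrite wu w1 w2 /=; move: sizes refined_sizes; clear; lia.
Qed.

Lemma no_jump_to_u2 : attached_to [:: u2; y1; y2] -> ~~ adj w u2.
Proof.
move=> att; apply/negP=> wu.
have w2 : ~~ adj w y2 by apply: jump_to_odd_hole_L2 wu; rewrite !inE eqxx orbT.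
have hole_z := jump_from_z (M := [:: i2; iy1; iy2]) (r := _) refined_skeleton erefl att.
move: (hole_z [:: iz4; i4; i1; i2]) (hole_z [:: iz3; i3; i2])
  (hole_z [:: iz4; i4; iy2; i2]) => /=.
by rewrite wu w2 /=; move: sizes refined_sizes; clear; lia.
Qed.

Lemma no_jump_to_u3 : attached_to [:: u3; y1; y2] -> ~~ adj w u3.
Proof.
move=> att; apply/negP=> wu.
have w1 : ~~ adj w y1 by apply: jump_to_odd_hole_L1 wu; rewrite !inE eqxx !orbT.
have hole_z := jump_from_z (M := [:: i3; iy1; iy2]) (r := _) refined_skeleton erefl att.
move: (hole_z [:: iz3; i3]) (hole_z [:: iz4; i4; i1; i2; i3])
  (hole_z [:: iz4; i4; i1; iy1; i3]) => /=.
by rewrite wu w1 /=; move: sizes refined_sizes; clear; lia.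
Qed.

Lemma no_jump_to_u4 : attached_to [:: u4; y1; y2] -> ~~ adj w u4.
Proof.
move=> att; apply/negP=> wu.
have w2 : ~~ adj w y2 by apply: jump_to_odd_hole_L2 wu; rewrite !inE eqxx !orbT.
have hole_z := jump_from_z (M := [:: i4; iy1; iy2]) (r := _) refined_skeleton erefl att.
move: (hole_z [:: iz4; i4]) (hole_z [:: iz3; i3; i2; i1; i4])
  (hole_z [:: iz3; i3; i2; iy2; i4]) => /=.
by rewrite wu w2 /=; move: sizes refined_sizes; clear; lia.
Qed.

Lemma no_jump_to_P1 y : y \in P1 -> attached_to [:: y; y1; y2] -> ~~ adj w y.
Proof.
move=> y_P1 att; apply/negP=> wy.
have w1 : ~~ adj w y1 by apply: jump_to_odd_hole_L1 wy; rewrite !(mem_cat, inE) y_P1 !orbT.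
have w2 : ~~ adj w y2 by apply: jump_to_odd_hole_L2 wy; rewrite !(mem_cat, inE) y_P1 !orbT.
have [s1 [s2 P1E]] := mem_split y_P1.
have P1_size : size P1 = size s1 + (size s2).+1 by rewrite P1E size_cat.
have sk' := skeleton_subdivide (k := 0) refined_skeleton isT P1E.
have hole_z := jump_from_z (M := [:: iy; iy1; iy2]) (r := _) sk' erefl att.
move: (hole_z [:: iz4; i4; i1; iy]) (hole_z [:: iz3; i3; i2; iy])
  (hole_z [:: iz4; i4; iy2; i2; iy]) (hole_z [:: iz3; i3; iy1; i1; iy]) => /=.
by rewrite wy w1 w2 /=; move: sizes refined_sizes P1_size; clear; lia.
Qed.

Lemma no_jump_to_Q2 y : y \in Q2 -> attached_to [:: y; y1; y2] -> ~~ adj w y.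
Proof.
move=> y_Q2 att; apply/negP=> wy.
have w2 : ~~ adj w y2 by apply: jump_to_odd_hole_L2 wy; rewrite !(mem_cat, inE) y_Q2 !orbT.
have [s1 [s2 Q2E]] := mem_split y_Q2.
have Q2_size : size Q2 = size s1 + (size s2).+1 by rewrite Q2E size_cat.
have sk' := skeleton_subdivide (k := 2) refined_skeleton isT Q2E.
have hole_z := jump_from_z (M := [:: iy; iy1; iy2]) (r := _) sk' erefl att.
move: (hole_z [:: iz4; i4; iy]) (hole_z [:: iz3; i3; i2; i1; iy])
  (hole_z [:: iz4; i4; iy2; i2; i1; iy]) (hole_z [:: iz3; i3; i2; iy2; i4; iy]) => /=.
by rewrite wy w2 /=; move: sizes refined_sizes Q2_size; clear; lia.
Qed.

Lemma no_jump_to_S3 y : y \in S3 -> attached_to [:: y; y1; y2] -> ~~ adj w y.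
Proof.
move=> y_S3 att; apply/negP=> wy; have [s1 [s2 S3E]] := mem_split y_S3.
have S3_size : size S3 = size s1 + (size s2).+1 by rewrite S3E size_cat.
have sk' := skeleton_subdivide (k := 3) refined_skeleton isT S3E.
have hole_z := jump_from_z (M := [:: iy; iy1; iy2]) (r := _) sk' erefl att.
have hole_w := jump_over_w (M := [:: iy; iy1; iy2]) (i := iy1) (r := _) sk' erefl att.
have y1_lengths : adj w y1 ->
    [|| size L1a == 0, size p + size S4 + size Q2 + size L1a + 6 == 2 * l + 1 |
        size p + size S4 + size Q2 + size P1 + size L1b + 8 == 2 * l + 1].
  move=> w1; move: (hole_z [:: iz4; i4; i1; iy1]) (hole_z [:: iz4; i4; i1; i2; i3; iy1]) => /=.
  by rewrite w1 /=; move: sizes refined_sizes S3_size; clear; lia.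
have y2_lengths : adj w y2 ->
    [|| size L2b == 0, size p + size S4 + size L2b + 5 == 2 * l + 1 |
        size p + size S4 + size Q2 + size P1 + size L2a + 7 == 2 * l + 1].
  move=> w2; move: (hole_z [:: iz4; i4; iy2]) (hole_z [:: iz4; i4; i1; i2; iy2]) => /=.
  by rewrite w2 /=; move: sizes refined_sizes S3_size; clear; lia.
have [w1|w1] := boolP (adj w y1).
  have [w2|w2] := boolP (adj w y2).
    move: (y1_lengths w1) (y2_lengths w2) (hole_z [:: iz3; iy]) (hole_w [:: i1; i4; iy2]) => /=.
    by rewrite wy w1 w2 /=; move: sizes refined_sizes S3_size; clear; lia.
  move: (hole_z [:: iz3; iy]) (hole_z [:: iz4; i4; i1; i2; i3; iy])
    (hole_z [:: iz4; i4; iy2; i2; i3; iy]) => /=.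
  by rewrite wy (negbTE w2) /=; move: sizes refined_sizes S3_size; clear; lia.
move: (hole_z [:: iz3; iy]) (hole_z [:: iz4; i4; i1; i2; i3; iy])
  (hole_z [:: iz4; i4; i1; iy1; i3; iy]) => /=.
by rewrite wy (negbTE w1) /=; move: sizes refined_sizes S3_size; clear; lia.
Qed.

Lemma no_jump_to_S4 y : y \in S4 -> attached_to [:: y; y1; y2] -> ~~ adj w y.
Proof.
move=> y_S4 att; apply/negP=> wy; have [s1 [s2 S4E]] := mem_split y_S4.
have S4_size : size S4 = size s1 + (size s2).+1 by rewrite S4E size_cat.
have sk' := skeleton_subdivide (k := 6) refined_skeleton isT S4E.
have hole_z := jump_from_z (M := [:: iy; iy1; iy2]) (r := _) sk' erefl att.
have hole_w := jump_over_w (M := [:: iy; iy1; iy2]) (i := iy1) (r := _) sk' erefl att.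
have y1_lengths : adj w y1 ->
    [|| size L1b == 0, size p + size S3 + size L1b + 5 == 2 * l + 1 |
        size p + size S3 + size P1 + size L1a + 7 == 2 * l + 1].
  move=> w1; move: (hole_z [:: iz3; i3; iy1]) (hole_z [:: iz3; i3; i2; i1; iy1]) => /=.
  by rewrite w1 /=; move: sizes refined_sizes S4_size; clear; lia.
have y2_lengths : adj w y2 ->
    [|| size L2a == 0, size p + size S3 + size L2a + 6 == 2 * l + 1 |
        size p + size S3 + size P1 + size Q2 + size L2b + 8 == 2 * l + 1].
  move=> w2; move: (hole_z [:: iz3; i3; i2; iy2]) (hole_z [:: iz3; i3; i2; i1; i4; iy2]) => /=.
  by rewrite w2 /=; move: sizes refined_sizes S4_size; clear; lia.
have [w1|w1] := boolP (adj w y1).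
  have [w2|w2] := boolP (adj w y2).
    move: (y1_lengths w1) (y2_lengths w2) (hole_z [:: iz4; iy]) (hole_w [:: i3; i2; iy2]) => /=.
    by rewrite wy w1 w2 /=; move: sizes refined_sizes S4_size; clear; lia.
  move: (hole_z [:: iz4; iy]) (hole_z [:: iz3; i3; i2; i1; i4; iy])
    (hole_z [:: iz3; i3; i2; iy2; i4; iy]) => /=.
  by rewrite wy (negbTE w2) /=; move: sizes refined_sizes S4_size; clear; lia.
move: (hole_z [:: iz4; iy]) (hole_z [:: iz3; i3; i2; i1; i4; iy])
  (hole_z [:: iz3; i3; iy1; i1; i4; iy]) => /=.
by rewrite wy (negbTE w1) /=; move: sizes refined_sizes S4_size; clear; lia.
Qed.

Lemma jump_to_z3 : ~~ adj w z -> ~~ adj w z4 -> adj w z3 ->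
  attached_to [:: z3; z4; y1; y2] -> ~~ (adj w y1 || adj w y2).
Proof.
move=> wz w4 w3 att; rewrite negb_or.
have hole_z := jump_from_z (M := [:: iz3; iz4; iy1; iy2]) (r := _) refined_skeleton erefl att.
have hole_w := jump_over_w (M := [:: iz3; iz4; iy1; iy2]) (i := iz3) (r := _)
  refined_skeleton erefl att.
have w2 : ~~ adj w y2.
  apply/negP=> w2; move: (hole_z [:: iz3]) (hole_z [:: iz4; i4; iy2])
    (hole_z [:: iz4; i4; i1; i2; iy2]) (hole_w [:: iz; iz4; i4; iy2]) => /=.
  by rewrite wz w4 w3 w2 /=; move: sizes refined_sizes; clear; lia.
rewrite w2 andbT; apply/negP=> w1.
move: (hole_z [:: iz3]) (hole_z [:: iz4; i4; i1; iy1]) (hole_z [:: iz4; i4; i1; i2; i3; iy1])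
  (hole_z [:: iz4; i4; iy2; i2; i1; iy1]) (hole_w [:: iz; iz4; i4; i1; iy1]) => /=.
by rewrite wz w4 w3 w2 w1 /=; move: sizes refined_sizes; clear; lia.
Qed.

Lemma jump_to_z4 : ~~ adj w z -> ~~ adj w z3 -> adj w z4 ->
  attached_to [:: z3; z4; y1; y2] -> ~~ (adj w y1 || adj w y2).
Proof.
move=> wz w3 w4 att; rewrite negb_or.
have hole_z := jump_from_z (M := [:: iz3; iz4; iy1; iy2]) (r := _) refined_skeleton erefl att.
have hole_w := jump_over_w (M := [:: iz3; iz4; iy1; iy2]) (i := iz4) (r := _)
  refined_skeleton erefl att.
have w2 : ~~ adj w y2.
  apply/negP=> w2; move: (hole_z [:: iz4]) (hole_z [:: iz3; i3; i2; iy2])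
    (hole_z [:: iz3; i3; i2; i1; i4; iy2]) (hole_w [:: iz; iz3; i3; i2; iy2]) => /=.
  by rewrite wz w3 w4 w2 /=; move: sizes refined_sizes; clear; lia.
rewrite w2 andbT; apply/negP=> w1.
move: (hole_z [:: iz4]) (hole_z [:: iz3; i3; iy1]) (hole_z [:: iz3; i3; i2; i1; iy1])
  (hole_w [:: iz; iz3; i3; iy1]) => /=.
by rewrite wz w3 w4 w1 /=; move: sizes refined_sizes; clear; lia.
Qed.

Lemma jump_to_z3_z4 y : y \in [:: z3; z4] -> adj w y -> attached_to [:: y; y1; y2] ->
  ~~ (adj w y1 || adj w y2).
Proof.
move=> y34 wy att; have yP2 : y \in odd_hole_P2.
  by move: y34; rewrite !(mem_cat, inE) => /orP[]->; rewrite ?orbT.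
have off_y v : v \in window_nodes -> v != y -> ~~ adj w v.
  by move=> v_nd; apply: contraNN => wv; rewrite (odd_hole_P2_one_neighbour w_off _ yP2 wv wy) //
    mem_cat v_nd.
have z_neq34 i : i \in [:: iz3; iz4] -> z != nth u1 window_nodes i.
  move=> i34; apply/eqP=> /(node_inj sk (i := iz) isT) z_i.
  by move: i34; rewrite !inE => /orP[]/eqP iE; move: z_i; rewrite iE => /(_ isT).
have z34 : z3 != z4 by apply/eqP=> /(node_inj sk (i := iz3) (j := iz4) isT isT).
have att34 : attached_to [:: z3; z4; y1; y2].
  move=> v vU wv vz; have := att v vU wv vz; rewrite inE => /orP[/eqP->|v12].
    by rewrite -[_ :: _]/([:: z3; z4] ++ [:: y1; y2]) mem_cat y34.
  by rewrite -[_ :: _]/([:: z3; z4] ++ [:: y1; y2]) mem_cat v12 orbT.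
move: y34 off_y wy; rewrite !inE => /orP[]/eqP-> off_y wy.
  apply: jump_to_z3 att34 => //; apply: off_y; rewrite ?inE ?eqxx ?orbT //.
    exact: (z_neq34 iz3).
  by rewrite eq_sym.
apply: jump_to_z4 att34 => //; apply: off_y; rewrite ?inE ?eqxx ?orbT //.
exact: (z_neq34 iz4).
Qed.

Lemma jump_to_odd_hole_P2 y : y \in odd_hole_P2 -> adj w y -> y != z ->
  attached_to [:: y; y1; y2] -> y \in [:: z3; z4].
Proof.
rewrite /odd_hole_P2 !mem_cat => /or4P[|yP1|yQ2|/orP[yS3|yS4]] wy yz att.
- move: wy yz att; rewrite !inE => + + +; case/or4P=> [| | |/or4P[]]/eqP-> wy yz att.
  + by case/negP: (no_jump_to_u1 att).
  + by case/negP: (no_jump_to_u2 att).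
  + by case/negP: (no_jump_to_u3 att).
  + by case/negP: (no_jump_to_u4 att).
  + by rewrite eqxx.
  + by rewrite eqxx in yz.
  + by rewrite eqxx orbT.
- by case/negP: (no_jump_to_P1 yP1 att).
- by case/negP: (no_jump_to_Q2 yQ2 att).
- by case/negP: (no_jump_to_S3 yS3 att).
- by case/negP: (no_jump_to_S4 yS4 att).
Qed.

End Refined.
Lemma jump_target x : x \in U -> adj w x -> x != z -> x \in [:: z3; z4].
Proof.
move=> xU wx xz; have [L1_gt0 L2_gt0] : 0 < size L1 /\ 0 < size L2.
  by move: sizes; clear; split; lia.
have [|L1a [y1 [L1b [L1E to_y1]]]] := at_most_one_neighbour_split (w := w) L1_gt0.
  by move=> v v' vL1 v'L1; apply: (odd_hole_L1_one_neighbour w_off);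
    rewrite !mem_cat ?vL1 ?v'L1 !orbT.
have [|L2a [y2 [L2b [L2E to_y2]]]] := at_most_one_neighbour_split (w := w) L2_gt0.
  by move=> v v' vL2 v'L2; apply: (odd_hole_L2_one_neighbour w_off);
    rewrite !mem_cat ?vL2 ?v'L2 !orbT.
have only_y1_y2 v : v \in [:: y1; y2] -> adj w v -> ~ ~~ (adj w y1 || adj w y2).
  by rewrite !inE => /orP[]/eqP-> ->; rewrite ?orbT.
have [/hasP[y yP2 /andP[wy yz]]|/hasPn offP2] :=
    boolP (has (fun v => adj w v && (v != z)) odd_hole_P2); last first.
  have att : attached_to [:: y1; y2].
    move=> v vU wv vz; rewrite !inE; case/or3P: (window_vertex vU).
    - by move/to_y1->; rewrite ?eqxx.
    - by move/to_y2->; rewrite ?eqxx ?orbT.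
    - by move/offP2; rewrite wv vz.
  by case: (only_y1_y2 x (att x xU wx xz) wx); apply: no_jump_to_L1_L2 L1E L2E att.
have att : attached_to [:: y; y1; y2].
  move=> v vU wv vz; rewrite !inE; case/or3P: (window_vertex vU).
  - by move/to_y1->; rewrite ?eqxx ?orbT.
  - by move/to_y2->; rewrite ?eqxx ?orbT.
  - by move/(odd_hole_P2_one_neighbour w_off)/(_ yP2 wv wy)->; rewrite eqxx.
have y34 := jump_to_odd_hole_P2 L1E L2E yP2 wy yz att.
have := att x xU wx xz; rewrite inE => /orP[/eqP->//|/only_y1_y2/(_ wx)[]].
exact: (jump_to_z3_z4 L1E L2E y34 wy att).
Qed.

End Jump.

(* A path from [z4] to [z3] outside of [U] would replace [z] both in the odd hole P1 Q1 P2 Q2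
   and in the even hole P2 Q1 L2. *)
Lemma no_detour_around_z h p :
    induced_path (h :: p) -> {in h :: p, forall v, v \notin U} ->
    adj z4 h -> adj (last h p) z3 ->
  ~ {in h :: p & U, forall v x, adj v x ->
       [\/ v = h /\ x = z4, v = last h p /\ x = z3 | x = z]}.
Proof.
move=> ind_hp hp_off z4h last_z3 att.
have detour r : [&& open_route window_nodes window_segments iz4 r, 0 < size r,
    last iz4 r == iz3 & iz \notin iz4 :: r] ->
  hole_length l (size p + route_length window_segments iz4 r + 2).
  case/and4P=> rt r_gt0 /eqP end_r z_r; have /andP[/and4P[_ path_r _ _] _] := rt.
  apply: (ear_length sk l_ge2 oneG rt r_gt0 ind_hp hp_off z4h); rewrite end_r // => v x vp xr vx.
  have xU : x \in U.
    move: xr; rewrite inE => /orP[/eqP->|]; first exact: (node_in_skeleton sk (i := iz4)).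
    exact: trail_in_skeleton.
  case: (att v x vp xU vx) => [[-> ->]|[-> ->]|xz]; [by left|by right|].
  move: xr z_r; rewrite xz !inE negb_or => /orP[/eqP|/(trail_node sk (m := iz) path_r isT)->].
    by move/(node_inj sk (i := iz) (j := iz4) isT isT).
  by rewrite andbF.
have p_gt0 : 0 < size p.
  case: (p) last_z3 hp_off => //= hz3 /(_ h (mem_head _ _)) hU.
  have : z3 = z4; last by move/(node_inj sk (i := iz3) (j := iz4) isT isT).
  apply: (odd_hole_P2_one_neighbour hU) => //; last by rewrite adj_sym.
    by rewrite mem_cat !inE eqxx !orbT.
  by rewrite mem_cat !inE eqxx !orbT.
move: (detour [:: i4; i1; i2; i3; iz3]) (detour [:: i4; i2; i3; iz3]) => /=.
by move: sizes p_gt0; clear; lia.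
Qed.

Lemma neighbours_of_z x : x \in U -> adj z x -> x \in [:: z3; z4].
Proof.
move=> xU zx; have [t t_sg /andP[inc e]] := node_neighbour sk (i := iz) isT xU zx.
have xz : x != z by apply: contraTneq zx => ->; rewrite adj_irrefl.
have /andP[_] := on_path_edge_mem e; move: inc; move: t_sg; rewrite !inE.
case/or4P=> [| | |/or4P[| | |/or3P[]]]/eqP-> //= _; rewrite !inE (negbTE xz).
  by rewrite orbF => ->.
by move=> /= ->; rewrite orbT.
Qed.

Lemma adj_z3_z : adj z3 z.
Proof.
case: (sk) => _ _ paths _; have := paths (iz3, iz, [::]).
by rewrite !inE !eqxx !orbT /= => /(_ isT)/andP[].
Qed.

Lemma adj_z_z4 : adj z z4.
Proof.
case: (sk) => _ _ paths _; have := paths (iz, iz4, [::]).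
by rewrite !inE !eqxx !orbT /= => /(_ isT)/andP[].
Qed.


(** * The component hanging off the middle of P2 *)

Definition outside_z3_z4 v : bool := [&& v \notin U, ~~ adj z3 v & ~~ adj z4 v].

Lemma adj_z3_z4 : ~~ adj z3 z4.
Proof. exact: (triangle_free l_ge2 oneG adj_z3_z adj_z_z4). Qed.

Lemma z3_neq_z4 : z3 != z4.
Proof. by apply/eqP=> /(node_inj sk (i := iz3) (j := iz4) isT isT). Qed.

Section Component.
Variable w0 : G.
Hypotheses (adj_z_w0 : adj z w0) (w0_neq : w0 \notin [:: z3; z4]).

Definition component : pred G := connect (adj_in outside_z3_z4) w0.

Lemma component_w0 : component w0.
Proof. exact: connect0. Qed.

Lemma component_outside v : component v -> outside_z3_z4 v.
Proof.
apply: connect_adj_in; apply/and3P; split.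
- by apply: contra w0_neq => /neighbours_of_z; apply.
- exact: (triangle_free l_ge2 oneG adj_z3_z adj_z_w0).
- by apply: (triangle_free l_ge2 oneG _ adj_z_w0); rewrite adj_sym adj_z_z4.
Qed.

Lemma component_off v : component v -> v \notin U.
Proof. by case/component_outside/and3P. Qed.

Lemma component_path u v : component u -> component v ->
  exists p, [/\ path (@adj G) u p, all component (u :: p) & last u p = v].
Proof.
move=> Fu Fv; have /connectP[p path_p ->] : connect (adj_in outside_z3_z4) u v.
  by apply: connect_trans Fv; rewrite (connect_adj_in_sym outside_z3_z4).
exists p; split=> //; first by have /andP[] := path_adj_in path_p.
by apply/allP=> x xp; apply: connect_trans Fu (path_connect path_p xp).
Qed.

Lemma component_attachment f x : component f -> x \in U -> adj f x -> x = z.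
Proof.
move=> Ff xU fx; apply/eqP/negPn/negP => xz.
have [p [path_p Fp last_p]] := component_path component_w0 Ff.
pose attached v := [exists y, [&& y \in U, adj v y & y != z]].
have [|h [q [ind_hq Fq [zh first_h] [att_last last_q]]]] :=
    @shortest_link _ component (adj z) attached w0 p.
  apply/and4P; split=> //; rewrite last_p; apply/existsP; exists x.
  by rewrite xU fx xz.
have /existsP[y /and3P[yU wy yz]] := att_last.
have /component_outside/and3P[_ w3 w4] : component (last h q) by apply/(allP Fq)/mem_last.
have : y \in [:: z3; z4].
  apply: (jump_target ind_hq _ zh _ yU wy yz) => [v /(allP Fq)/component_off//|].
  move=> v x' vq x'U vx'; have [x'z|x'z] := eqVneq x' z.
    by left; split=> //; apply: first_h => //; rewrite -x'z adj_sym.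
  by right; split=> //; apply: last_q => //; apply/existsP; exists x'; rewrite x'U vx' x'z.
rewrite !inE => /orP[]/eqP yE; move: wy; rewrite yE adj_sym; exact/negP.
Qed.

Lemma boundary_attachment n f x y : component f -> adj n f -> n \notin U ->
  x \in [:: z3; z4] -> adj n x -> y \in U -> adj n y -> y = x.
Proof.
move=> Ff nf nU x34 nx yU ny; have [p [path_p Fp last_p]] := component_path component_w0 Ff.
have uniq_nbr v : v \in [:: z3; z; z4] -> adj n v -> v = x.
  have in_hole u : u \in [:: z3; z; z4] -> u \in odd_hole_P2.
    by move=> uz; rewrite mem_cat (mem_drop (n0 := 4)).
  move=> v_z nv; apply: (odd_hole_P2_one_neighbour nU) nv nx; apply: in_hole => //.
  by move: x34; rewrite !inE => /orP[]->; rewrite ?orbT.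
have nz : ~~ adj n z.
  apply/negP=> nz; move: x34; rewrite -(uniq_nbr z) ?inE ?eqxx ?orbT //.
  by case/orP=> /eqP zE; [have := adj_z3_z|have := adj_z_z4]; rewrite -zE adj_irrefl.
have [|h [q [ind_hq Fq [zh first_h] [/eqP last_n _]]]] :=
    @shortest_link _ (fun v => component v || (v == n)) (adj z) (pred1 n) w0 (rcons p n).
  rewrite /link rcons_path path_p last_p adj_sym nf last_rcons /= eqxx all_rcons eqxx orbT.
  rewrite adj_z_w0 component_w0 /= !andbT; case/andP: Fp => _.
  by apply: sub_all => v ->.
have yz : y != z by apply: contraTneq ny => ->.
apply: uniq_nbr => //; suff : y \in [:: z3; z4] by rewrite !inE => /orP[]->; rewrite ?orbT.
apply: (jump_target ind_hq _ zh _ yU _ yz) => [v /(allP Fq)/orP[/component_off//|/eqP->//]||].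
  move=> v v' vq v'U vv'; case/orP: (allP Fq v vq) => [Fv|/eqP vn].
    have v'z := component_attachment Fv v'U vv'; left; split=> //.
    by apply: first_h => //; rewrite -v'z adj_sym.
  by right; rewrite last_n; split=> //; apply: contraTneq vv' => ->; rewrite vn.
by rewrite last_n.
Qed.

Lemma boundary_one_sided n3 f3 n4 f4 :
    component f3 -> adj n3 f3 -> n3 \notin U -> adj n3 z3 ->
    component f4 -> adj n4 f4 -> n4 \notin U ->
  ~~ adj n4 z4.
Proof.
move=> Ff3 n3f3 n3U n3z3 Ff4 n4f4 n4U; apply/negP=> n4z4.
have [p [path_p Fp last_p]] := component_path Ff4 Ff3.
pose D v := [|| component v, v == n3 | v == n4].
have [|h [q [ind_hq Dq [z4h first_h] [last_z3 last_q]]]] :=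
    @shortest_link _ D (adj z4) (fun v => adj v z3) n4 (f4 :: rcons p n3).
  rewrite /link /= rcons_path path_p last_p last_rcons n4f4 (adj_sym f3) n3f3 n3z3 adj_sym n4z4.
  rewrite all_rcons /D !eqxx !orbT; case/andP: Fp => -> Fp /=; rewrite andbT.
  by apply: sub_all Fp => v ->.
apply: (no_detour_around_z ind_hq _ z4h last_z3).
  by move=> v /(allP Dq)/or3P[/component_off//|/eqP->|/eqP->].
move=> v x vq xU vx; case/or3P: (allP Dq v vq) => [Fv|/eqP vE|/eqP vE].
- by constructor 3; apply: component_attachment Fv xU vx.
- constructor 2; rewrite vE in vx vq.
  have -> := boundary_attachment Ff3 n3f3 n3U (mem_head _ _) n3z3 xU vx.
  by rewrite vE; split=> //; apply: last_q.
- constructor 1; rewrite vE in vx vq.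
  have x4 : z4 \in [:: z3; z4] by rewrite !inE eqxx orbT.
  have -> := boundary_attachment Ff4 n4f4 n4U x4 n4z4 xU vx.
  by rewrite vE; split=> //; apply: first_h; rewrite // adj_sym.
Qed.

Lemma component_boundary f v : component f -> adj f v -> v \notin U ->
  [|| component v, adj z3 v | adj z4 v].
Proof.
move=> Ff fv vU; have [|v3] := boolP (adj z3 v); first by rewrite orbT.
have [|v4] := boolP (adj z4 v); first by rewrite !orbT.
apply/orP; left; apply: (connect_trans Ff); apply: connect1.
by rewrite /adj_in fv (component_outside Ff) /outside_z3_z4 vU v3 v4.
Qed.

Lemma component_star_cutset x y : vertex_critical4 G ->
    x \in [:: z3; z4] -> y \in [:: z3; z4] -> y != x ->
  ~ (forall f v, component f -> adj f v -> v \notin U -> component v || adj x v).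
Proof.
move=> crit x34 y34 yx bd.
have inU u : u \in [:: z3; z4] -> u \in U.
  by rewrite !inE => /orP[]/eqP->;
    [exact: (node_in_skeleton sk (i := iz3))|exact: (node_in_skeleton sk (i := iz4))].
apply: (no_star_cutset l_ge2 oneG crit component_w0 _ yx).
- by apply/negP=> /component_off; rewrite inU.
- move: x34 y34 yx; rewrite !inE => /orP[]/eqP-> /orP[]/eqP->; rewrite ?eqxx ?adj_z3_z4 //.
  by rewrite adj_sym adj_z3_z4.
- move=> v Fv; have /and3P[vU v3 v4] := component_outside Fv.
  have -> : v != x by apply: contraNneq vU => ->; apply: inU.
  by move: x34; rewrite !inE => /orP[]/eqP->.
move=> f v Ff fv; have [vU|vU] := boolP (v \in U); last first.
  by case/orP: (bd f v Ff fv vU) => ->; rewrite ?orbT.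
rewrite (component_attachment Ff vU fv); apply/or3P/Or33.
by move: x34; rewrite !inE => /orP[]/eqP->; rewrite ?adj_z3_z // adj_sym adj_z_z4.
Qed.

Lemma component_not_critical : ~ vertex_critical4 G.
Proof.
move=> crit.
have [/existsP[n3 /existsP[f3 /and4P[n3U n3z3 Ff3 n3f3]]]|/existsPn no_n3] :=
  boolP [exists n, exists f, [&& n \notin U, adj n z3, component f & adj n f]].
  apply: (component_star_cutset (x := z3) (y := z4) crit); rewrite ?inE ?eqxx ?orbT //.
    by rewrite eq_sym z3_neq_z4.
  move=> f v Ff fv vU; case/or3P: (component_boundary Ff fv vU) => [->|->|z4v]; rewrite ?orbT //.
  have vf : adj v f by rewrite adj_sym.
  have := boundary_one_sided Ff3 n3f3 n3U n3z3 Ff vf vU.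
  by rewrite adj_sym z4v.
apply: (component_star_cutset (x := z4) (y := z3) crit); rewrite ?inE ?eqxx ?orbT ?z3_neq_z4 //.
move=> f v Ff fv vU; case/or3P: (component_boundary Ff fv vU) => [->|z3v|->]; rewrite ?orbT //.
have /existsPn/(_ f) := no_n3 v.
by rewrite vU Ff (adj_sym v z3) z3v (adj_sym v f) fv.
Qed.

End Component.

Lemma window_not_critical : ~ vertex_critical4 G.
Proof.
move=> crit; have [w0 zw0 w0_neq] : exists2 w, adj z w & w \notin [:: z3; z4].
  have /subsetPn[w] : ~~ ([set w | adj z w] \subset [set z3; z4]).
    apply/negP=> /subset_leq_card; apply/negP; rewrite -ltnNge cards2.
    by apply: leq_trans (critical4_degree_ge3 z crit); case: (_ != _).
  by rewrite !inE => zw w_neq; exists w; rewrite ?inE.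
exact: (component_not_critical zw0 w0_neq crit).
Qed.
End Window.

Lemma split_middle (T : Type) (s : seq T) : 4 <= size s ->
  exists a x y z b, s = a ++ [:: x, y, z & b] /\ size b <= size a <= size b + 1.
Proof.
move=> size_s; pose k := (size s - 2)./2.
have sE := cat_take_drop k s; have size_drop_s := size_drop k s.
have size_take_s : size (take k s) = k by rewrite size_takel // /k; clear; lia.
case: (drop k s) sE size_drop_s => [|x [|y [|z b]]] sE /= size_b;
  try by move: size_b size_s; rewrite /k; clear; lia.
exists (take k s), x, y, z, b; split=> //.
by move: size_b size_s; rewrite size_take_s /k; clear; lia.
Qed.

Lemma window_skeleton (G : sgraph) U (u1 u2 u3 u4 z3 z z4 : G) (P1 Q2 S3 S4 L1 L2 : seq G) :
    skeleton u1 U [:: u1; u2; u3; u4]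
      (k4_segments P1 [::] Q2 (S3 ++ [:: z3, z, z4 & S4]) L1 L2) ->
  skeleton u1 U (window_nodes u1 u2 u3 u4 z3 z z4) (window_segments P1 Q2 S3 S4 L1 L2).
Proof.
move=> sk; have sk_z3 := skeleton_subdivide (k := 3) sk isT erefl.
have sk_z := skeleton_subdivide (k := 4) (p := [::]) sk_z3 isT erefl.
exact: (skeleton_subdivide (k := 5) (p := [::]) sk_z isT erefl).
Qed.

Theorem theorem3p2 (l : nat) (hl : 5 <= l) (G : sgraph)
  (hgirth : has_girth G (2 * l + 1))
  (hodd : forall c : seq G, odd_hole c -> ~~ (2 * l + 3 <= size c))
  (hcrit : vertex_critical4 G) :
  ~ contains_balanced_K4_subdivision_12 G.
Proof.
case/balanced_K4_skeleton=> u1 [u2 [u3 [u4 [P1 [Q2 [P2 [L1 [L2 []]]]]]]]].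
move=> sk odd1 odd2 even3 L2_gt0.
have oneG : one_odd_hole_length l G by case: hgirth.
have l_ge2 : 2 <= l by apply: leq_trans hl.
have /and4P[L1_len L2_len P2_len P2_ge] := balanced_lengths l_ge2 oneG sk odd1 odd2 even3 L2_gt0.
have [S3 [z3 [z [z4 [S4 [P2E halves]]]]]] : exists S3 z3 z z4 S4,
    P2 = S3 ++ [:: z3, z, z4 & S4] /\ size S4 <= size S3 <= size S4 + 1.
  by apply: split_middle; move: P2_ge hl; clear; lia.
have size_P2 : size P2 = size S3 + size S4 + 3 by rewrite P2E size_cat /=; clear; lia.
move: sk; rewrite P2E => /window_skeleton sk.
apply: (window_not_critical oneG sk _ hcrit).
rewrite hl L1_len L2_len -size_P2 P2_len halves andbT /=.
by move: P2_ge; rewrite size_P2; clear; lia.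
Qed.
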